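(* Let $\Omega\subset\mathbb{R}^n$ be a bounded smooth domain, let $0<s<1$ and let $q\in[1,2^*_s)$, $q\ne 2$. For $\varepsilon>0$ let $\Omega_\varepsilon=\{\varepsilon x : x\in\Omega\}$. Then $$\lim_{\varepsilon\downarrow 0}\frac{S(\Omega_\varepsilon)}{\varepsilon^{n(1-\frac2q)}}=|\Omega|^{1-\frac2q}.$$ Moreover, if $u_\varepsilon\in H^s(\Omega_\varepsilon)$ is an extremal for $S(\Omega_\varepsilon)$, then the rescaled extremals $\bar u_\varepsilon(x):=u_\varepsilon(\varepsilon x)$, $x\in\Omega$, normalized such that $\|\bar u_\varepsilon\|_{q;\Omega}=1$, verify that $$\bar u_\varepsilon\to|\Omega|^{-\frac1q}\quad\text{strongly in } H^s(\Omega)$$ as $\varepsilon\downarrow 0$, where $|\Omega|^{-\frac1q}$ denotes the constant function.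
   Context: $|\Omega|$ is the Lebesgue measure of $\Omega$. $2^*_s:=\frac{2n}{n-2s}$ if $2s<n$ and $2^*_s:=\infty$ otherwise. For an open set $U\subset\mathbb{R}^n$, $\|u\|_{r;U}$ denotes the $L^r(U)$-norm, $[u]_{s;U}:=\left(\iint_{U\times U}\frac{(u(x)-u(y))^2}{|x-y|^{n+2s}}\,dx\,dy\right)^{1/2}$, and $H^s(U):=\{u\in L^2(U): [u]_{s;U}<\infty\}$ (real-valued functions), with norm $\|u\|_{s;U}:=([u]_{s;U}^2+\|u\|_{2;U}^2)^{1/2}$. The Sobolev constant is $$S(U):=\inf_{u\in H^s(U),\,u\neq 0}\frac{\|u\|_{s;U}^2}{\|u\|_{q;U}^2},$$ and an extremal for $S(U)$ is a nonzero $u\in H^s(U)$ at which this infimum is attained.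
   Formalization: The normalization fixes extremals only up to sign (the negative of an extremal is also one), so convergence to |Ω|^{-1/q} is proved after multiplying each rescaled extremal by a suitable sign ±1, which is +1 whenever the rescaled extremal is nonnegative a.e. in Ω. *)

(* Defs.v *)
From HB Require Import structures.
From mathcomp Require Import all_boot all_order all_algebra.
From mathcomp Require Import all_classical all_reals all_analysis.
Set Implicit Arguments.
Unset Strict Implicit.
Unset Printing Implicit Defensive.
Import Order.TTheory GRing.Theory Num.Theory.
Import numFieldNormedType.Exports.
Local Open Scope classical_set_scope.
Local Open Scope ring_scope.

(* R^n is 'rV[R]_n, with the sigma-algebra generated by the coordinates
   (the Borel sigma-algebra).  The library norm on 'rV[R]_n is the sup norm:
   it is only used for its topology and for boundedness. *)

Definition measure_row_display : measure_display -> measure_display.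
Proof. exact. Qed.

Section measurable_row.
Context {d} {T : sigmaRingType d}.
Variable n : nat.

Let coors : 'I_n -> 'rV[T]_n -> T := fun i x => x ord0 i.

Let row_set0 : g_sigma_preimage coors set0.
Proof. exact: sigma_algebra0. Qed.

Let row_setC A : g_sigma_preimage coors A -> g_sigma_preimage coors (~` A).
Proof. exact: sigma_algebraC. Qed.

Let row_bigcup (F : _^nat) : (forall i, g_sigma_preimage coors (F i)) ->
  g_sigma_preimage coors (\bigcup_i (F i)).
Proof. exact: sigma_algebra_bigcup. Qed.

HB.instance Definition _ := @isMeasurable.Build (measure_row_display d)
  'rV[T]_n (g_sigma_preimage coors) row_set0 row_setC row_bigcup.

End measurable_row.

Lemma measurable_row_coord d (T : sigmaRingType d) n (i : 'I_n) :
  measurable_fun [set: 'rV[T]_n] (fun x => x ord0 i).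
Proof.
move=> _ Y mY; rewrite setTI; apply: sub_sigma_algebra => /=.
rewrite -bigcup_seq/=; exists i => /=; first by rewrite mem_index_enum.
by exists Y => //; rewrite setTI.
Qed.

Lemma measurable_fun_row d d' (X : measurableType d) (T : measurableType d') n
    (f : X -> 'rV[T]_n) :
  (forall i, measurable_fun [set: X] (fun x => f x ord0 i)) ->
  measurable_fun [set: X] f.
Proof.
move=> mf.
have sub : g_sigma_preimage (fun i x => f x ord0 i) `<=` measurable.
  apply: smallest_sub; first exact: sigma_algebra_measurable.
  rewrite -bigcup_seq/=; apply: bigcup_sub => i _ A [B mB <-].
  exact: mf.
move=> _ A mA; apply: sub.
rewrite (_ : (fun i x => f x ord0 i) =
  (fun i => (fun v : 'rV[T]_n => v ord0 i) \o f))//.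
by rewrite g_sigma_preimage_comp; exists A.
Qed.

Section lebesgue_row.
Context {R : realType}.

Definition row_cons n (p : measurableTypeR R * 'rV[R]_n) : 'rV[R]_n.+1 :=
  row_mx (p.1 : R)%:M p.2.

Definition row_uncons n (x : 'rV[R]_n.+1) : measurableTypeR R * 'rV[R]_n :=
  (x ord0 ord0, @rsubmx R 1 1 n x).

Lemma row_consK n : cancel (@row_cons n) (@row_uncons n).
Proof.
move=> [a v]; congr pair; last exact: row_mxKr.
transitivity (row_mx (a : R)%:M v ord0 (lshift n (ord0 : 'I_1))).
  by congr (row_mx _ _ _ _); exact/val_inj.
by rewrite row_mxEl mxE eqxx mulr1n.
Qed.

Lemma measurable_row_cons n : measurable_fun setT (@row_cons n).
Proof.
apply: measurable_fun_row => i; rewrite -(@splitK 1 n i).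
case: (@fintype.split 1 n i) => j /=.
  rewrite (_ : (fun x => _) = (fun x => x.1)).
    exact: measurable_fst.
  apply/funext => x; apply: etrans (row_mxEl _ _ _ _) _.
  by rewrite (ord1 j) mxE eqxx mulr1n.
rewrite (_ : (fun x => _) =
    (fun x : measurableTypeR R * 'rV[R]_n => x.2 ord0 j)).
  exact: (measurableT_comp (measurable_row_coord j) measurable_snd).
by apply/funext => x; exact: row_mxEr.
Qed.

Lemma measurable_row_uncons n : measurable_fun setT (@row_uncons n).
Proof.
apply: measurable_fun_pair => /=; first exact: measurable_row_coord.
apply: measurable_fun_row => i.
rewrite (_ : (fun x => _) = (fun x : 'rV[R]_n.+1 => x ord0 (rshift 1 i))).
  exact: measurable_row_coord.
by apply/funext => x; rewrite mxE.
Qed.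

Section lebesgue_rowS.
Variables (n : nat) (mu : {sigma_finite_measure set 'rV[R]_n -> \bar R}).

Definition lebesgue_rowS : set 'rV[R]_n.+1 -> \bar R :=
  pushforward (lebesgue_measure \x mu)%E (@row_cons n).

Let lebesgue_rowS0 : lebesgue_rowS set0 = 0%E.
Proof. by rewrite /lebesgue_rowS /pushforward preimage_set0 measure0. Qed.

Let lebesgue_rowS_ge0 A : (0 <= lebesgue_rowS A)%E.
Proof. by rewrite /lebesgue_rowS /pushforward measure_ge0. Qed.

Let lebesgue_rowS_sigma_additive : semi_sigma_additive lebesgue_rowS.
Proof.
move=> F mF tF mUF; rewrite /lebesgue_rowS /pushforward preimage_bigcup.
have mpre A : measurable A -> measurable (@row_cons n @^-1` A).
  by move=> mA; rewrite -[X in measurable X]setTI; exact: measurable_row_cons.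
apply: measure_semi_sigma_additive.
- by move=> k; exact: mpre.
- apply/trivIsetP => /= i j _ _ ij; rewrite -preimage_setI.
  by move/trivIsetP : tF => /(_ _ _ _ _ ij) ->//; rewrite preimage_set0.
- by rewrite -preimage_bigcup; exact: mpre.
Qed.

HB.instance Definition _ := isMeasure.Build _ _ _ lebesgue_rowS
  lebesgue_rowS0 lebesgue_rowS_ge0 lebesgue_rowS_sigma_additive.

Let lebesgue_rowS_sigma_finite : sigma_finite setT lebesgue_rowS.
Proof.
have /sigma_finiteP[F [TF ndF Foo]] :=
  sigma_finiteT (@lebesgue_measure R : {sigma_finite_measure set _ -> \bar R}).
have /sigma_finiteP[G [TG ndG Goo]] := sigma_finiteT mu.
exists (fun i => @row_uncons n @^-1` (F i `*` G i)).
  rewrite -preimage_bigcup; apply/esym/seteqP; split=> // x _.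
  have [k _ Fk] : (\bigcup_i F i) (row_uncons x).1 by rewrite -TF.
  have [l _ Gl] : (\bigcup_i G i) (row_uncons x).2 by rewrite -TG.
  exists (maxn k l) => //; split.
  - by move: Fk; exact/subsetPset/ndF/leq_maxl.
  - by move: Gl; exact/subsetPset/ndG/leq_maxr.
move=> i; have [mF Fi] := Foo i; have [mG Gi] := Goo i; split.
  rewrite -[X in measurable X]setTI; apply: measurable_row_uncons => //.
  exact: measurableX.
rewrite /lebesgue_rowS /pushforward -comp_preimage.
rewrite (_ : _ \o _ = id); last by apply/funext => x /=; rewrite row_consK.
by rewrite preimage_id product_measure1E// lte_mul_pinfty// ge0_fin_numE.
Qed.

HB.instance Definition _ := Measure_isSigmaFinite.Build _ _ _ lebesgue_rowS
  lebesgue_rowS_sigma_finite.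

End lebesgue_rowS.

(* Lebesgue measure on R^n, as the n-fold product of Lebesgue measure on R;
   on the one-point space R^0 it is the Dirac mass. *)
Fixpoint lebesgue_row (n : nat) :
    {sigma_finite_measure set 'rV[R]_n -> \bar R} :=
  if n is n'.+1 then lebesgue_rowS (lebesgue_row n') else \d_(0 : 'rV[R]_0).

End lebesgue_row.

Section smooth_domain.
Context {R : realType}.

Fixpoint continuously_diff (m k : nat) (f : 'rV[R]_m -> R) : Prop :=
  if k is k'.+1 then
    continuous f /\ forall i : 'I_m,
      (forall x, derivable f x (delta_mx 0 i)) /\
      continuously_diff k' (fun x => 'D_(delta_mx 0 i) f x)
  else continuous f.

Definition smooth (m : nat) (f : 'rV[R]_m -> R) : Prop :=
  forall k, continuously_diff k f.

(* Near each boundary point, U is, up to the choice of one coordinate axis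
   and of its orientation, the strict epigraph of a smooth function of the
   other coordinates. *)
Definition smooth_boundary (n : nat) (U : set 'rV[R]_n) : Prop :=
  forall x0 : 'rV[R]_n, (closure U `\` U°) x0 ->
  exists (r : R) (i : 'I_n) (b : bool) (g : 'rV[R]_n.-1 -> R),
    [/\ 0 < r, smooth g &
      U `&` ball x0 r =
      [set x | g (col' i x) < (-1) ^+ b * x ord0 i] `&` ball x0 r].

Definition bounded_smooth_domain (n : nat) (U : set 'rV[R]_n) : Prop :=
  [/\ open U, connected U, U !=set0, bounded_set U & smooth_boundary U].

End smooth_domain.

Section fractional_sobolev.
Context {R : realType} {n : nat}.
Implicit Types (U : set 'rV[R]_n) (u : 'rV[R]_n -> R).
Local Notation mu := (@lebesgue_row R n).

Definition euclidean_norm (x : 'rV[R]_n) : R :=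
  Num.sqrt (\sum_(i < n) x ord0 i ^+ 2).

Definition scale_set (e : R) U : set 'rV[R]_n := [set e *: x | x in U].

Definition critical_exponent (s : R) : \bar R :=
  if 2 * s < n%:R then (2 * n%:R / (n%:R - 2 * s))%:E else +oo%E.

Local Open Scope ereal_scope.

Definition Lr_norm (r : R) U u : \bar R := 'N[mu]_(r%:E)[EFin \o (u \_ U)].

(* On the diagonal the integrand is 0 / 0 = 0. *)
Definition gagliardo (s : R) U u : \bar R :=
  (\int[mu \x mu]_(z in U `*` U)
     ((u z.1 - u z.2) ^+ 2 /
      euclidean_norm (z.1 - z.2) `^ (n%:R + 2 * s))%:E) `^ 2^-1.

Definition Hs (s : R) U : set ('rV[R]_n -> R) :=
  [set u | [/\ measurable_fun U u, Lr_norm 2 U u < +oo &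
               gagliardo s U u < +oo]].

Definition Hs_norm (s : R) U u : \bar R :=
  (gagliardo s U u ^+ 2 + Lr_norm 2 U u ^+ 2) `^ 2^-1.

(* Elements of Hs are functions, so being zero means vanishing a.e. on U. *)
Definition Hs_nonzero (s : R) U : set ('rV[R]_n -> R) :=
  Hs s U `&` [set u | ~ {ae mu, forall x, U x -> u x = 0%R}].

Definition sobolev_quotient (s q : R) U u : \bar R :=
  Hs_norm s U u ^+ 2 / Lr_norm q U u ^+ 2.

Definition sobolev_constant (s q : R) U : \bar R :=
  ereal_inf (sobolev_quotient s q U @` Hs_nonzero s U).

Definition extremal (s q : R) U u : Prop :=
  Hs_nonzero s U u /\ sobolev_quotient s q U u = sobolev_constant s q U.

End fractional_sobolev.
Arguments critical_exponent {R} n s.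

(* Main.v *)
(* Rescaling turns the quotient on the dilated domain, divided by
   e^(n (1 - 2/q)), into (e^(-2s) [v]^2 + |v|_2^2) / |v|_q^2 on Omega.  The
   constant function gives the upper bound |Omega|^(1 - 2/q).  For the lower
   bound, one has |v - m|_2, |v - m|_q <= C [v] for a suitable constant m, so that
   |v|_q <= |Omega|^(1/q - 1/2) |v|_2 + C' [v], and Cauchy-Schwarz bounds the
   quotient below by 1 / (|Omega|^(2/q - 1) + C'^2 e^(2s)).  For an extremal,
   [v] = O(e^s), which makes v close to a constant of prescribed L^q norm.

   The L^q inequality needs no extension operator: a bounded smooth domain has
   measure density |Omega `&` B(x, r)| >= c r^n, and comparing w x with the values
   of w on Omega `&` B(x, r), for r chosen in terms of
   h x = int_Omega (w x - w y)^2 / |x - y|^(n + 2s) dy, gives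
   |w x|^(2 + 2sp/n) <= C (1 + h x) as soon as w is bounded in L^p.  Hence L^p
   bounds improve to L^(2 + 2sp/n) bounds, and iterating from p = 2 reaches every
   subcritical exponent. *)
Require Import Defs.
From HB Require Import structures.
From mathcomp Require Import all_boot all_order all_algebra.
From mathcomp Require Import all_classical all_reals all_analysis.
From mathcomp Require Import measurable_realfun ring lra.
Import Order.TTheory GRing.Theory Num.Theory.
Import numFieldNormedType.Exports.
Set Implicit Arguments.
Unset Strict Implicit.
Unset Printing Implicit Defensive.
Local Open Scope classical_set_scope.
Local Open Scope ring_scope.

(** * Lebesgue measure on row vectors *)

Lemma ball_rowP (R : realType) n (x y : 'rV[R]_n) (r : R) :
  ball x r y <-> 0 < r /\ forall i, `|x ord0 i - y ord0 i| < r.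
Proof.
split=> [[r0 h]|[r0 h]]; split=> //; first by move=> i; exact: h.
by move=> i j; rewrite (ord1 i); exact: h.
Qed.

Definition box {R : realType} {n} (a b : 'rV[R]_n) : set 'rV[R]_n :=
  [set x | forall i, a ord0 i < x ord0 i < b ord0 i].

Lemma measurable_box (R : realType) n (a b : 'rV[R]_n) : measurable (box a b).
Proof.
have -> : box a b = \bigcap_(i in [set: 'I_n])
    ((fun x : 'rV[R]_n => x ord0 i) @^-1` `]a ord0 i, b ord0 i[).
  apply/seteqP; split=> x /= h i; first by move=> _ /=; rewrite in_itv/=.
  by have := h i I; rewrite /= in_itv.
apply: fin_bigcap_measurable => // i _; rewrite -[X in measurable X]setTI.
exact: measurable_row_coord.
Qed.

Lemma ball_box (R : realType) n (x : 'rV[R]_n) (r : R) : 0 < r ->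
  ball x r = box (\row_i (x ord0 i - r)) (\row_i (x ord0 i + r)).
Proof.
move=> r0; apply/seteqP; split=> y.
  by move/ball_rowP => [_ h] i; rewrite !mxE; have := h i; rewrite ltr_norml; lra.
move=> h; apply/ball_rowP; split=> // i.
by have := h i; rewrite !mxE ltr_norml; lra.
Qed.

(** The sigma-algebra is generated by the coordinates, so openness must be reduced to boxes: [U] is
    the union of those cubes with rational centre and radius 1/(k+1) that it contains. *)
Lemma open_measurable_row (R : realType) n (U : set 'rV[R]_n) :
  open U -> measurable U.
Proof.
move=> oU.
pose B (p : 'rV[rat]_n * nat) : set 'rV[R]_n :=
  ball (\row_i (ratr (p.1 ord0 i) : R)) (p.2.+1%:R^-1).
pose F p := if pselect (B p `<=` U) is left _ then B p else set0.
have -> : U = \bigcup_p F p.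
  apply/seteqP; split=> [x Ux|x [p _]]; last first.
    by rewrite /F; case: pselect => // pU Bx; exact: pU.
  have /nbhs_ballP[e/= e0 xeU] : nbhs x U by exact: open_nbhs_nbhs.
  (* The centre is taken within 1/(k+1) of [x] and the cube has that same radius, hence the e /
     2. *)
  have [k ke] : exists k : nat, k.+1%:R^-1 < e / 2.
    exists (Num.truncn (e / 2)^-1); rewrite invf_plt ?posrE ?divr_gt0//.
    by rewrite truncnS_gt.
  have k0 : 0 < (k.+1%:R^-1 : R) by rewrite invr_gt0.
  have /choice[q hq] : forall i : 'I_n, exists q : rat,
      `|(ratr q : R) - x ord0 i| < k.+1%:R^-1.
    move=> i; have : x ord0 i - k.+1%:R^-1 < x ord0 i + k.+1%:R^-1.
      by rewrite ltrBlDr -addrA ltrDl addr_gt0.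
    move=> /rat_in_itvoo[q]; rewrite in_itv/= => h.
    by exists q; rewrite ltr_norml ltrBrDr ltrBlDr [- _ + _]addrC [_ + x _ _]addrC.
  exists (\row_i q i, k) => //.
  have BU : B (\row_i q i, k) `<=` U.
    move=> y /ball_rowP[_ h]; apply: xeU; apply/ball_rowP; split=> // i.
    have := h i; have := hq i; rewrite !mxE.
    move: (ratr _) (_^-1) ke => u v ke.
    rewrite !ltr_norml => /andP[? ?] /andP[? ?]; apply/andP; split; lra.
  rewrite /F; case: pselect => // _; apply/ball_rowP; split=> // i.
  by rewrite !mxE.
apply: countable_bigcupT_measurable => // p.
rewrite /F; case: pselect => // _.
rewrite /B ball_box ?invr_gt0//; exact: measurable_box.
Qed.


Section row_cons_theory.
Context {R : realType}.
Implicit Types n : nat.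

Lemma row_cons0 n (p : measurableTypeR R * 'rV[R]_n) :
  row_cons p ord0 ord0 = p.1.
Proof. exact: (congr1 fst (row_consK p)). Qed.

Lemma row_consS n (p : measurableTypeR R * 'rV[R]_n) (i : 'I_n) :
  row_cons p ord0 (lift ord0 i) = p.2 ord0 i.
Proof.
have -> : lift ord0 i = rshift 1 i by apply: ord_inj; rewrite lift0.
exact: row_mxEr.
Qed.

Lemma row_cons_scale n (e : R) (p : measurableTypeR R * 'rV[R]_n) :
  e *: row_cons p = row_cons ((e * p.1 : R), e *: p.2).
Proof.
apply/rowP => i; rewrite mxE; case: (unliftP ord0 i) => [j|] ->.
  by rewrite !row_consS mxE.
by rewrite !row_cons0.
Qed.

End row_cons_theory.

Lemma lebesgue_row_box (R : realType) n (a b : 'rV[R]_n) :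
  (forall i, a ord0 i <= b ord0 i) ->
  lebesgue_row n (box a b) = (\prod_(i < n) (b ord0 i - a ord0 i))%:E.
Proof.
elim: n a b => [|n IH] a b ab.
  by rewrite big_ord0 /= diracE mem_set// => -[].
rewrite big_ord_recl /= /lebesgue_rowS /pushforward.
set a' : 'rV[R]_n := \row_i a ord0 (lift ord0 i).
set b' : 'rV[R]_n := \row_i b ord0 (lift ord0 i).
have -> : @row_cons R n @^-1` box a b = `]a ord0 ord0, b ord0 ord0[ `*` box a' b'.
  apply/seteqP; split=> -[c v] /= h.
    split; first by have := h ord0; rewrite in_itv /= row_cons0.
    by move=> i; have := h (lift ord0 i); rewrite row_consS !mxE.
  case: h => h1 h2 i; case: (unliftP ord0 i) => [j|] ->.
    by have := h2 j; rewrite row_consS !mxE.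
  by move: h1; rewrite in_itv /= row_cons0.
rewrite product_measure1E//; last exact: measurable_box.
rewrite IH; last by move=> i; rewrite !mxE.
rewrite EFinM; congr (_ * _)%E; last first.
  by congr (_%:E); apply: eq_bigr => i _; rewrite !mxE.
rewrite [LHS](lebesgue_measure_itv `]a ord0 ord0, b ord0 ord0[) /= lte_fin.
case: ltP => // h; suff -> : a ord0 ord0 = b ord0 ord0 by rewrite subrr.
by apply/eqP; rewrite eq_le h ab.
Qed.

Lemma measurable_row_scale (R : realType) n (e : R) :
  measurable_fun setT (fun x : 'rV[R]_n => e *: x).
Proof.
apply: measurable_fun_row => i.
rewrite (_ : (fun x => _) = (fun x : 'rV[R]_n => e * x ord0 i)); last first.
  by apply/funext => x; rewrite mxE.
apply: measurable_funM => //; exact: measurable_row_coord.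
Qed.

(** * Integrals under dilations, and Tonelli on products of sets *)

Local Open Scope ereal_scope.

(** The pushforward of Lebesgue measure under x |-> e x, multiplied by e, agrees with Lebesgue
    measure on half-open intervals; uniqueness of the measure extends this to all measurable
    sets. *)
Lemma ge0_integral_lebesgue_scale (R : realType) (e : R) (f : R -> \bar R) :
  (0 < e)%R -> measurable_fun setT f -> (forall x, 0 <= f x) ->
  \int[lebesgue_measure]_x f (e * x)%R =
  (e^-1)%:E * \int[lebesgue_measure]_x f x.
Proof.
move=> e0 mf f0.
have me : measurable_fun [set: measurableTypeR R]
    ((fun x => (e * x)%R) : _ -> measurableTypeR R) by exact: measurable_funM.
have ei : (0 <= e^-1)%R by rewrite invr_ge0 ltW.
pose phi : measurableTypeR R -> measurableTypeR R := fun x => (e * x)%R.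
rewrite -[LHS](ge0_integral_pushforward me lebesgue_measure measurableT mf)//.
rewrite -[(e^-1)%R]/((NngNum ei)%:num) -ge0_integral_mscale//.
apply: eq_measure_integral => A mA _.
have ge0e : (0 <= e)%R by exact: ltW.
suff h : lebesgue_measure A = e%:E * pushforward lebesgue_measure phi A.
  suff : pushforward lebesgue_measure (fun x => (e * x)%R) A =
      (e^-1)%:E * lebesgue_measure A by [].
  by rewrite h muleA -EFinM mulVf ?gt_eqF// mul1e.
suff K : forall X, ocitv X -> lebesgue_measure X =
    mscale (NngNum ge0e) (pushforward lebesgue_measure phi) X.
  exact: (lebesgue_measure_unique (K me) mA).
move=> m _ [[a b] _ <-].
transitivity (e%:E *
    lebesgue_measure `](e^-1 * a)%R, (e^-1 * b)%R]%classic); last first.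
  congr (_ * lebesgue_measure _); apply/seteqP.
  by split=> x /=; rewrite /phi !in_itv/= ltr_pdivrMl// ler_pdivlMl.
rewrite !lebesgue_measure_itv/= !lte_fin ltr_pM2l ?invr_gt0//.
case: ifP => _; last by rewrite mule0.
by rewrite -EFinB -EFinM -mulrBr mulrA divff ?gt_eqF// mul1r EFinB.
Qed.

Lemma ge0_integral_row_cons (R : realType) n (f : 'rV[R]_n.+1 -> \bar R) :
  measurable_fun setT f -> (forall x, 0 <= f x) ->
  \int[lebesgue_row n.+1]_x f x =
  \int[lebesgue_measure]_a \int[lebesgue_row n]_v f (row_cons (a, v)).
Proof.
move=> mf f0.
have := ge0_integral_pushforward (@measurable_row_cons R n)
  (lebesgue_measure \x lebesgue_row n) measurableT mf (fun _ _ => f0 _).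
have mfc := measurableT_comp mf (@measurable_row_cons R n).
by rewrite preimage_setT fubini_tonelli1// => z; exact: f0.
Qed.

(** Induction on the dimension: Tonelli separates the first coordinate, the tail contributes e^(-n)
    by induction and the first coordinate e^(-1). *)
Lemma ge0_integral_row_scale (R : realType) n (e : R) (f : 'rV[R]_n -> \bar R) :
  (0 < e)%R -> measurable_fun setT f -> (forall x, 0 <= f x) ->
  \int[lebesgue_row n]_x f (e *: x) =
  (e ^- n)%:E * \int[lebesgue_row n]_x f x.
Proof.
move=> e0; elim: n f => [|n IH] f mf f0.
  rewrite expr0 invr1 mul1e; apply: eq_integral => x _.
  by congr f; apply/rowP => -[].
have mfc := measurableT_comp mf (@measurable_row_cons R n).
rewrite !ge0_integral_row_cons//; last first.
  by apply: measurableT_comp => //; exact: measurable_row_scale.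
transitivity (\int[lebesgue_measure]_a ((e ^- n)%:E *
    \int[lebesgue_row n]_v f (row_cons ((e * a)%R : R, v)))).
  apply: eq_integral => a _.
  under eq_integral do rewrite row_cons_scale.
  rewrite (IH (fun v => f (row_cons ((e * a)%R, v))))//.
  apply: (measurableT_comp mfc).
  by apply: measurable_fun_pair => //; exact: measurable_cst.
have mF : measurable_fun [set: measurableTypeR R]
    (fun a => \int[lebesgue_row n]_v f (row_cons (a, v))).
  exact: (measurable_fun_fubini_tonelli_F _ mfc (fun z => f0 _)).
have scale1 (G : R -> \bar R) : measurable_fun setT G -> (forall a, 0 <= G a) ->
    \int[lebesgue_measure]_a ((e ^- n)%:E * G (e * a)%R) =
    (e ^- n.+1)%:E * \int[lebesgue_measure]_a G a.
  move=> mG G0; have mGe : measurable_fun setT (fun a => G (e * a)%R).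
    by apply: (measurableT_comp mG); exact: measurable_funM.
  rewrite ge0_integralZl_EFin ?invr_ge0 ?exprn_ge0 ?ltW//.
  by rewrite ge0_integral_lebesgue_scale// muleA -EFinM exprS invfM mulrC.
by apply: (scale1 _ mF) => a; exact: integral_ge0.
Qed.

Section tonelli.
Context d1 d2 (T1 : measurableType d1) (T2 : measurableType d2) (R : realType).
Variables (m1 : {sigma_finite_measure set T1 -> \bar R}).
Variables (m2 : {sigma_finite_measure set T2 -> \bar R}).
Variables (A : set T1) (B : set T2) (f : T1 * T2 -> \bar R).
Hypotheses (mA : measurable A) (mB : measurable B).
Hypothesis mf : measurable_fun (A `*` B) f.
Hypothesis f0 : forall z, (A `*` B) z -> 0 <= f z.

(** Extension by zero: measurability and sign of [f] are known on the rectangle only, while Tonelli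
    is stated on the whole product. *)
Let g := f \_ (A `*` B).

Let mg : measurable_fun setT g.
Proof. by apply/(measurable_restrictT _ _).1 => //; exact: measurableX. Qed.

Let g0 z : 0 <= g z. Proof. by apply: erestrict_ge0 => x; exact: f0. Qed.

Let gE x : A x -> \int[m2]_(y in B) f (x, y) = \int[m2]_y g (x, y).
Proof.
move=> Ax; rewrite integral_mkcond; apply: eq_integral => y _.
rewrite /g !patchE; congr (if _ then _ else _).
by apply/idP/idP; rewrite !inE// => -[].
Qed.

Lemma measurable_integral_prod_set :
  measurable_fun A (fun x => \int[m2]_(y in B) f (x, y)).
Proof.
apply: (@eq_measurable_fun _ _ _ _ _ (fun x => \int[m2]_y g (x, y))).
  by move=> x; rewrite inE => Ax; rewrite gE.
apply: measurable_funTS; exact: measurable_fun_fubini_tonelli_F.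
Qed.

Lemma ge0_integral_prod_set :
  \int[m1 \x m2]_(z in A `*` B) f z =
  \int[m1]_(x in A) \int[m2]_(y in B) f (x, y).
Proof.
rewrite integral_mkcond -/g fubini_tonelli1// [RHS]integral_mkcond.
apply: eq_integral => x _; rewrite patchE; case: ifPn => [|xA].
  by rewrite inE => Ax; rewrite gE.
rewrite /fubini_F integral0_eq// => y _.
rewrite /g patchE ifN//; apply: contra xA; rewrite !inE; by case.
Qed.

End tonelli.

Local Close Scope ereal_scope.

(** * Measure density of smooth domains *)

Lemma bounded_coord (R : realType) n (U : set 'rV[R]_n) : bounded_set U ->
  exists2 M, 0 < M & forall x, U x -> forall i, `|x ord0 i| <= M.
Proof.
case=> M [_ /(_ (`|M| + 1))] UM; exists (`|M| + 1).
  by rewrite ltr_wpDl.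
move=> x Ux i.
have h : M < `|M| + 1 by have := ler_norm M; lra.
apply: le_trans (UM h _ Ux); rewrite [leRHS]/Num.norm /= mx_normrE.
by apply/bigmax_geP; right => /=; exists (ord0, i).
Qed.

Lemma is_derive_line (R : realType) m (g : 'rV[R]_m -> R) (v w : 'rV[R]_m) (t : R) :
  derivable g (t *: v + w) v ->
  is_derive t 1 (fun s : R => g (s *: v + w)) ('D_v g (t *: v + w)).
Proof.
have E : (fun h : R => h^-1 *: (((fun s : R => g (s *: v + w)) \o shift t) (h *: 1)
              - g (t *: v + w))) =
         (fun h : R => h^-1 *: ((g \o shift (t *: v + w)) (h *: v) - g (t *: v + w))).
  apply/funext => h /=; congr (_ *: (g _ - _)).
  by rewrite addrA -scalerDl; congr ((_ + _) *: _ + _); exact: mulr1.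
by move=> dg; split; rewrite /derivable /derive E.
Qed.

(** The form with [Num.min] and [Num.max] allows either order of the endpoints, as needed when
    coordinates are changed one by one. *)
Lemma ler_segment_derive (R : realType) (f df : R -> R) (a b M : R) :
  (forall t : R, is_derive t 1 f (df t)) ->
  (forall t, t \in `[Num.min a b, Num.max a b] -> `|df t| <= M) ->
  `|f b - f a| <= M * `|b - a|.
Proof.
move=> fd; wlog ab : a b / a <= b => [H|] bM.
  case: (leP a b) => [|/ltW] ab; first exact: H.
  by rewrite distrC (distrC b); apply: H => //; rewrite minC maxC.
have cf : {within `[a, b], continuous f}.
  apply: continuous_subspaceT => t; apply/differentiable_continuous.
  by apply/derivable1_diffP; case: (fd t).
have [c + ->] := @MVT_segment R f df a b ab (fun t _ => fd t) cf.
rewrite normrM => cab; apply: ler_wpM2r => //; apply: bM.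
by rewrite min_l// max_r.
Qed.

(** The path from [x] to [y] changes one coordinate at a time and stays in the closed cube [K] about
    [p]. The partial derivatives are bounded on [K] by compactness, and the mean value inequality on
    each segment gives [L] as the sum of these bounds. *)
Lemma smooth_locally_lipschitz (R : realType) m (g : 'rV[R]_m -> R)
    (p : 'rV[R]_m) : smooth g ->
  exists2 L, 0 <= L & forall x y d, ball p 1 x -> ball p 1 y ->
    (forall i, `|y ord0 i - x ord0 i| <= d) -> g y - g x <= L * d.
Proof.
move=> /(_ 1%N)/= [_ dg].
pose K := [set v : 'rV[R]_m | forall i, `[p ord0 i - 1, p ord0 i + 1]%classic (v ord0 i)].
have cK : compact K.
  apply: (@rV_compact R m (fun i => `[p ord0 i - 1, p ord0 i + 1]%classic)).
  by move=> i; exact: segment_compact.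
have K0 : K !=set0.
  by exists p => i /=; rewrite in_itv/=; lra.
have /choice[M hM] : forall i : 'I_m, exists M, forall v, K v ->
    `|'D_(delta_mx 0 i) g v| <= M.
  move=> i; have cD : continuous (fun v => 'D_(delta_mx 0 i) g v) := (dg i).2.
  have cn : continuous (fun v => `|'D_(delta_mx 0 i) g v|).
    by move=> v; exact: (cvg_norm (cD v)).
  have [c _ hc] := EVT_max_rV K0 cK (continuous_subspaceT cn).
  by exists (`|'D_(delta_mx 0 i) g c|) => v Kv; apply: hc; rewrite inE.
have M0 i : 0 <= M i.
  by case: K0 => v /hM h; exact: le_trans (h i).
exists (\sum_i M i); first by apply: sumr_ge0 => i _.
move=> x y d px py xyd.
(* The first k coordinates come from [y], the others still from [x], so the increments telescope. *)
pose z (k : nat) : 'rV[R]_m := \row_j (if (j < k)%N then y ord0 j else x ord0 j).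
have Ez0 : z 0%N = x by apply/rowP => j; rewrite mxE.
have Ezm : z m = y by apply/rowP => j; rewrite mxE ltn_ord.
have -> : g y - g x = \sum_(i < m) (g (z i.+1) - g (z i)).
  by rewrite -Ez0 -Ezm -(big_mkord xpredT (fun i => g (z i.+1) - g (z i))) telescope_sumr.
rewrite mulr_suml; apply: ler_sum => k _.
(* Coordinate k of [w] is zero: [z k] and [z k.+1] both lie on the line t |-> w + t e_k. *)
pose w : 'rV[R]_m := z k - x ord0 k *: delta_mx 0 k.
have zE t : forall j, (t *: delta_mx 0 k + w) ord0 j =
    if j == k then t else z k ord0 j.
  move=> j; rewrite !mxE/=; case: eqVneq => [->|jk].
    by rewrite ltnn !mulr1; ring.
  by rewrite !mulr0 subr0 add0r.
have e1 : z k.+1 = y ord0 k *: delta_mx 0 k + w.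
  apply/rowP => j; rewrite zE !mxE ltnS leq_eqVlt (inj_eq val_inj).
  by case: eqVneq => [->|].
have e0 : z k = x ord0 k *: delta_mx 0 k + w.
  apply/rowP => j; rewrite zE !mxE.
  by case: eqVneq => [->|//]; rewrite ltnn.
have bx i : p ord0 i - 1 <= x ord0 i <= p ord0 i + 1.
  by have [_ /(_ i)] := (ball_rowP _ _ _).1 px; rewrite ltr_norml; lra.
have bY i : p ord0 i - 1 <= y ord0 i <= p ord0 i + 1.
  by have [_ /(_ i)] := (ball_rowP _ _ _).1 py; rewrite ltr_norml; lra.
apply: le_trans (ler_norm _) _; rewrite e1 e0.
apply: le_trans (_ : M k * `|y ord0 k - x ord0 k| <= _); last first.
  by apply: ler_wpM2l => //; exact: xyd.
apply: (@ler_segment_derive _ (fun t => g (t *: delta_mx 0 k + w))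
  (fun t => 'D_(delta_mx 0 k) g (t *: delta_mx 0 k + w))).
  by move=> t; apply: is_derive_line; case: (dg k).
move=> t ht; apply: hM => j /=; rewrite in_itv /= zE.
case: eqVneq => [->|jk]; last by rewrite mxE; case: ifP.
move: ht; rewrite in_itv/= ge_min le_max => /andP[/orP h1 /orP h2].
by have := bx k; have := bY k; case: h1; case: h2; lra.
Qed.

(** A single [c] serves as density constant and as bound on the radii. Decreasing it weakens the
    condition, so local constants can be made uniform by compactness. *)
Definition measure_density {R : realType} {n} (U : set 'rV[R]_n) (c : R)
  (x : 'rV[R]_n) := forall r : R, 0 < r <= c ->
    ((c * r ^+ n)%:E <= lebesgue_row n (U `&` ball x r))%E.

Lemma lebesgue_row_ball (R : realType) n (x : 'rV[R]_n) (r : R) : 0 < r ->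
  lebesgue_row n (ball x r) = ((2 * r) ^+ n)%:E.
Proof.
move=> r0; rewrite ball_box// lebesgue_row_box; last first.
  by move=> i; rewrite !mxE; lra.
congr EFin; rewrite -[in RHS](card_ord n) -prodr_const; apply: eq_bigr => i _.
by rewrite !mxE; ring.
Qed.

(** A cube of half-side k r has volume (2 k)^n r^n, which is at least c r^n; it thus suffices to fit
    such a cube inside. *)
Lemma measure_density_of_ball (R : realType) n (U : set 'rV[R]_n) (c k : R) x :
  measurable U -> 0 <= c -> 0 < k -> c <= (2 * k) ^+ n ->
  (forall r, 0 < r <= c -> exists y, ball y (k * r) `<=` U `&` ball x r) ->
  measure_density U c x.
Proof.
move=> mU c0 k0 ck h r rc; have r0 : 0 < r by case/andP: rc.
have [y yU] := h _ rc.
apply: (@le_trans _ _ (lebesgue_row n (ball y (k * r)))); last first.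
  apply: le_measure => //; rewrite inE.
    by rewrite ball_box ?mulr_gt0//; exact: measurable_box.
  by apply: measurableI => //; rewrite ball_box//; exact: measurable_box.
rewrite lebesgue_row_ball ?mulr_gt0// lee_fin mulrA exprMn ler_wpM2r// exprn_ge0//.
exact: ltW.
Qed.

(* If g is L-Lipschitz near x, moving x by a multiple of (L + 1) d in the vertical
   direction yields a cube of side of order d contained in the epigraph of g. *)
Lemma measure_density_boundary (R : realType) n (U : set 'rV[R]_n)
    (x0 : 'rV[R]_n) (r : R) (i : 'I_n) (b : bool) (g : 'rV[R]_n.-1 -> R) :
  measurable U -> 0 < r -> smooth g ->
  U `&` ball x0 r =
    [set x | g (col' i x) < (-1) ^+ b * x ord0 i] `&` ball x0 r ->
  exists2 c, 0 < c & forall c', 0 < c' <= c ->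
    forall x, ball x0 c x -> U x -> measure_density U c' x.
Proof.
move=> mU r0 sg UE.
have [L L0 gL] := smooth_locally_lipschitz (col' i x0) sg.
(* Over a cube of half-side k d, [g] varies by at most L k d = d / 2 - k d, which does not exceed
   the height gain d - 2 k d because k <= 1/2. *)
pose k := (2 * (L + 1))^-1.
have k0 : 0 < k by rewrite invr_gt0; lra.
have kL : 2 * (k * (L + 1)) = 1 by rewrite /k invfM; field; lra.
have kn : 0 < (2 * k) ^+ n by rewrite exprn_gt0// mulr_gt0.
(* Two steps of length c stay within r of [x0], and their projections within the unit ball where [L]
   is valid; the last term is the volume condition of [measure_density_of_ball]. *)
pose c := Num.min (Num.min (r / 2) (2^-1)) ((2 * k) ^+ n).
have c0 : 0 < c by rewrite /c !lt_min kn invr_gt0 ltr0n divr_gt0.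
have : c <= r / 2 /\ c <= 2^-1 /\ c <= (2 * k) ^+ n.
  by rewrite /c !ge_min !lexx !orbT.
move=> [cr [c2 ck]].
exists c => // c' /andP[c'0 c'c] x x0x Ux.
apply: (@measure_density_of_ball _ _ _ _ k) => //; first exact: ltW.
  exact: le_trans ck.
move=> d /andP[d0 dc'].
have dc : d <= c by exact: le_trans c'c.
set sg' : R := (-1) ^+ b.
(* The shift d - k d leaves room for the cube of half-side k d about [y] inside [ball x d]. *)
pose y := x + (sg' * (d - k * d)) *: delta_mx 0 i.
have kd0 : 0 < k * d by exact: mulr_gt0.
have k12 : k <= 2^-1.
  by move: kL; have := mulr_ge0 (ltW k0) L0; lra.
have kd2 : k * d <= d / 2 by rewrite mulrC ler_pM2l.
exists y => z yz.
have [_ zy] := (ball_rowP _ _ _).1 yz.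
have [_ xx0] := (ball_rowP _ _ _).1 x0x.
have sgi : sg' * z ord0 i > sg' * x ord0 i + d - 2 * (k * d) /\ `|x ord0 i - z ord0 i| < d.
  have := zy i; rewrite !mxE !eqxx mulr1; move: kd0 kd2.
  move: (k * d) => kd kd0 kd2.
  have [->|->] : sg' = 1 \/ sg' = -1.
    by rewrite /sg'; case: (b); [right; rewrite expr1|left; rewrite expr0].
  - by rewrite !ltr_norml => /andP[h1 h2]; split; [|apply/andP; split]; lra.
  - by rewrite !ltr_norml => /andP[h1 h2]; split; [|apply/andP; split]; lra.
have xz j : `|x ord0 j - z ord0 j| < d.
  have [->|ji] := eqVneq j i; first by case: sgi.
  have := zy j; rewrite !mxE (negbTE ji) andbF mulr0 addr0; lra.
have xzb : ball x d z by apply/ball_rowP.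
split=> //.
suff : (U `&` ball x0 r) z by case.
rewrite UE; split; last first.
  apply: le_ball (ball_triangle x0x xzb); lra.
have gx : g (col' i x) < sg' * x ord0 i.
  suff : ([set x | g (col' i x) < sg' * x ord0 i] `&` ball x0 r) x by case.
  by rewrite -UE; split=> //; apply: le_ball x0x; lra.
have bcol (u v : 'rV[R]_n) e : ball u e v -> ball (col' i u) e (col' i v).
  by move=> /ball_rowP[e0 h]; apply/ball_rowP; split=> // j; rewrite !mxE.
have h : g (col' i z) - g (col' i x) <= L * (k * d).
  apply: gL.
  - by apply: le_ball (bcol _ _ _ x0x); lra.
  - by apply: le_ball (bcol _ _ _ (ball_triangle x0x xzb)); lra.
  - move=> j; rewrite !mxE distrC ltW//; have := zy (lift i j).
    by rewrite !mxE [lift i j == i]eq_sym (negbTE (neq_lift _ _)) andbF mulr0 addr0.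
rewrite /=; case: sgi => h2 _.
have : L * (k * d) = (2 * (k * (L + 1))) * d / 2 - k * d by field.
rewrite kL mul1r => h3; rewrite -/sg'; lra.
Qed.

(** Interior points carry a full ball and boundary points the epigraph bound; both give a constant
    valid in a neighbourhood, and compactness of the closure makes it uniform. *)
Lemma bounded_smooth_domain_measure_density (R : realType) n (U : set 'rV[R]_n) :
  bounded_smooth_domain U ->
  exists2 c, 0 < c & forall x, U x -> measure_density U c x.
Proof.
move=> [oU _ _ bU sU].
have mU : measurable U by exact: open_measurable_row.
have cU : compact (closure U).
  have [M _ UM] := bounded_coord bU.
  have cB : compact [set v : 'rV[R]_n | forall i, `[- M, M]%classic (v ord0 i)].
    apply: (@rV_compact R n (fun=> `[- M, M]%classic)).
    by move=> i; exact: segment_compact.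
  apply: (subclosed_compact _ cB) => //; first exact: closed_closure.
  rewrite [X in _ `<=` X](closure_id _).1.
    apply: closure_subset => v /UM vM i /=.
    by rewrite in_itv/= -ler_norml.
  by apply: compact_closed => //; exact: norm_hausdorff.
(* Compactness as a covering principle: it is enough to find, near each [x0], a range 0 < c' <= c of
   constants valid on a whole neighbourhood. *)
have : \forall c \near (0 : R)^'+, closure U `<=` [set x | U x -> measure_density U c x].
  apply: (compact_near_coveringP _).1 => // x0 Ux0.
  suff [c c0 hc] : exists2 c, 0 < c & forall c', 0 < c' <= c ->
      forall x, ball x0 c x -> U x -> measure_density U c' x.
    exists (ball x0 c, [set c' | 0 < c' <= c]) => /=; last first.
      by move=> [x c'] [/= h1 h2]; exact: hc.
    split; first exact: nbhsx_ballx.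
    near=> c'; rewrite /=; apply/andP; split => //; near: c'.
    exact: nbhs_right_le.
  have [Ux|nUx] := pselect (U x0); last first.
    have [|r [i [b [g [r0 sg UE]]]]] := sU x0; first by split=> // /interior_subset.
    exact: (measure_density_boundary mU r0 sg UE).
  have /nbhs_ballP[r/= r0 hr] : nbhs x0 U by exact: open_nbhs_nbhs.
  exists (Num.min (r / 2) 1) => [|c' /andP[c'0]].
    by rewrite lt_min ltr01 andbT divr_gt0.
  rewrite le_min => /andP[c'r c'1] x x0x _.
  apply: (@measure_density_of_ball _ _ _ _ 1) => //; first exact: ltW.
    by apply: le_trans c'1 _; rewrite mulr1 exprn_ege1// ler1n.
  move=> d /andP[d0 dc']; exists x; rewrite mul1r => z xz; split=> //.
  apply: hr; apply: le_ball (ball_triangle x0x xz).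
  apply: (@le_trans _ _ (r / 2 + r / 2)); last lra.
  by apply: lerD; rewrite ?ge_min ?lexx//; exact: le_trans c'r.
move=> h; near (0 : R)^'+ => c; exists c => // x Ux.
by apply: (near h c) => //; exact: subset_closure.
Unshelve. all: by end_near. Qed.

(** * The Gagliardo energy *)

(** Infinite values are included, so that norms can be squared before their finiteness is known. *)
Lemma poweR_half_sqr (R : realType) (x : \bar R) :
  (0 <= x -> (x `^ 2^-1) ^+ 2 = x)%E.
Proof.
case: x => [x| |]//.
  by rewrite lee_fin => x0; rewrite poweR_EFin powR12_sqrt// -EFin_expe sqr_sqrtr.
by move=> _; rewrite poweRyr ?invr_eq0// expe2 mulyy.
Qed.

Lemma euclidean_norm_ge0 (R : realType) n (x : 'rV[R]_n) : 0 <= euclidean_norm x.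
Proof. exact: sqrtr_ge0. Qed.

Lemma euclidean_norm_eq0 (R : realType) n (x : 'rV[R]_n) :
  euclidean_norm x = 0 -> x = 0.
Proof.
move/eqP; rewrite sqrtr_eq0 => h; apply/rowP => i; rewrite mxE; apply/eqP.
have /psumr_eq0P : \sum_(i < n) x ord0 i ^+ 2 = 0.
  by apply/eqP; rewrite eq_le h sumr_ge0// => j _; exact: sqr_ge0.
move=> /(_ (fun j _ => sqr_ge0 _) i isT)/eqP; by rewrite sqrf_eq0.
Qed.

Lemma euclidean_norm_scale (R : realType) n (e : R) (x : 'rV[R]_n) : 0 <= e ->
  euclidean_norm (e *: x) = e * euclidean_norm x.
Proof.
move=> e0; rewrite /euclidean_norm.
under eq_bigr do rewrite mxE exprMn.
by rewrite -mulr_sumr sqrtrM ?sqr_ge0// sqrtr_sqr ger0_norm.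
Qed.

Lemma euclidean_norm_le (R : realType) n (x : 'rV[R]_n) (r : R) : 0 <= r ->
  (forall i, `|x ord0 i| <= r) -> euclidean_norm x <= n%:R * r.
Proof.
move=> r0 xr; rewrite -[leRHS]ger0_norm ?mulr_ge0// -sqrtr_sqr ler_wsqrtr//.
apply: (@le_trans _ _ (\sum_(i < n) r ^+ 2)).
  by apply: ler_sum => i _; rewrite -real_normK ?num_real// ler_pXn2r ?nnegrE.
rewrite sumr_const card_ord -[leLHS]mulr_natl exprMn ler_wpM2r ?sqr_ge0//.
by case: n {x xr} => [|m]; rewrite ?expr0n// expr2 ler_peMr// ler1n.
Qed.

Lemma measurable_euclidean_norm (R : realType) n :
  measurable_fun setT (@euclidean_norm R n).
Proof.
apply: (measurableT_comp (continuous_measurable_fun (@sqrt_continuous R))) => //.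
apply: measurable_sum => i; apply: measurable_funX.
exact: measurable_row_coord.
Qed.

Section gagliardo_kernel.
Context {R : realType} {n : nat}.
Implicit Types (U : set 'rV[R]_n) (u v w : 'rV[R]_n -> R) (s p q r d : R).
Local Notation mu := (@lebesgue_row R n).

Definition gagliardo_kernel s u (z : 'rV[R]_n * 'rV[R]_n) : R :=
  (u z.1 - u z.2) ^+ 2 / euclidean_norm (z.1 - z.2) `^ (n%:R + 2 * s).

(** The square of [gagliardo]: without the root, it is accessible to Tonelli and to changes of
    variables. *)
Definition gagliardo_energy s U u : \bar R :=
  (\int[mu \x mu]_(z in U `*` U) (gagliardo_kernel s u z)%:E)%E.

Definition power_integral r U u : \bar R :=
  (\int[mu]_(x in U) (`|u x| `^ r)%:E)%E.

Lemma gagliardo_kernel_ge0 s u z : 0 <= gagliardo_kernel s u z.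
Proof. by rewrite divr_ge0 ?sqr_ge0 ?powR_ge0. Qed.

Lemma gagliardo_energy_ge0 s U u : (0 <= gagliardo_energy s U u)%E.
Proof. by apply: integral_ge0 => z _; rewrite lee_fin gagliardo_kernel_ge0. Qed.

Lemma power_integral_ge0 r U u : (0 <= power_integral r U u)%E.
Proof. by apply: integral_ge0 => z _; rewrite lee_fin powR_ge0. Qed.

Lemma gagliardo_sqr s U u : (gagliardo s U u ^+ 2 = gagliardo_energy s U u)%E.
Proof.
rewrite /gagliardo -/(gagliardo_kernel s u) -/(gagliardo_energy s U u).
exact/poweR_half_sqr/gagliardo_energy_ge0.
Qed.

Lemma gagliardo_ge0 s U u : (0 <= gagliardo s U u)%E.
Proof. exact: poweR_ge0. Qed.

Lemma Lr_normE r U u : r != 0 -> measurable U ->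
  Lr_norm r U u = (power_integral r U u `^ r^-1)%E.
Proof.
move=> r0 mU; rewrite /Lr_norm unlock /power_integral [in RHS]integral_mkcond.
congr poweR; apply: eq_integral => x _ /=; rewrite !patchE.
case: ifPn => // _.
by rewrite (_ : point = 0 :> R)// (_ : point = 0%E :> \bar R)// normr0 powR0.
Qed.

(** The exponent n + 2 s is positive, so the distance may be replaced by its bound [d]. On the
    diagonal the left side vanishes, so the value of 0 / 0 is harmless. *)
Lemma gagliardo_kernel_lower s u d z : 0 <= s -> (0 < n)%N ->
  euclidean_norm (z.1 - z.2) <= d ->
  (u z.1 - u z.2) ^+ 2 <= d `^ (n%:R + 2 * s) * gagliardo_kernel s u z.
Proof.
move=> s0 n0 zd.
have [/euclidean_norm_eq0/subr0_eq e|e0] := eqVneq (euclidean_norm (z.1 - z.2)) 0.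
  by rewrite e subrr expr0n/= mulr_ge0// ?powR_ge0 ?gagliardo_kernel_ge0.
have en0 : 0 < euclidean_norm (z.1 - z.2) by rewrite lt_def e0 euclidean_norm_ge0.
rewrite /gagliardo_kernel mulrCA ler_peMr ?sqr_ge0//.
rewrite ler_pdivlMr ?powR_gt0// mul1r ge0_ler_powR ?nnegrE//.
- by rewrite addr_ge0// mulr_ge0.
- exact: ltW.
- by apply: le_trans zd; exact: ltW.
Qed.

Lemma measurable_gagliardo_kernel s U u : measurable U -> measurable_fun U u ->
  measurable_fun (U `*` U) (gagliardo_kernel s u).
Proof.
move=> mU mu_.
have mUU : measurable (U `*` U) by exact: measurableX.
have m1 : measurable_fun (U `*` U) (fun z => u z.1).
  apply: (measurable_comp mU _ mu_); first by move=> _ [z [? ?] <-].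
  by apply: measurable_funTS; exact: measurable_fst.
have m2 : measurable_fun (U `*` U) (fun z => u z.2).
  apply: (measurable_comp mU _ mu_); first by move=> _ [z [? ?] <-].
  by apply: measurable_funTS; exact: measurable_snd.
apply: measurable_funM; first by apply: measurable_funX; exact: measurable_funB.
apply: measurable_funTS; under eq_fun do rewrite -powRN.
apply: (measurableT_comp (@measurable_powR R _)).
apply: (measurableT_comp (@measurable_euclidean_norm R n)).
apply: measurable_fun_row => i.
rewrite (_ : (fun x => _) =
  (fun z : 'rV[R]_n * 'rV[R]_n => z.1 ord0 i - z.2 ord0 i)); last first.
  by apply/funext => z; rewrite !mxE.
apply: measurable_funB.
  exact: (measurableT_comp (measurable_row_coord i) measurable_fst).
exact: (measurableT_comp (measurable_row_coord i) measurable_snd).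
Qed.

End gagliardo_kernel.

(** * Poincare and Sobolev inequalities *)

Section embedding.
Context {R : realType} {n : nat}.
Variables (U : set 'rV[R]_n) (s D c V : R).
Hypotheses (n0 : (0 < n)%N) (s0 : 0 < s) (D0 : 0 < D) (c0 : 0 < c) (V0 : 0 < V).
Hypothesis mU : measurable U.
Hypothesis UV : lebesgue_row n U = V%:E.
Hypothesis UD : forall x y, U x -> U y -> euclidean_norm (x - y) <= D.
Hypothesis dU : forall x, U x -> measure_density U c x.
Implicit Types (u v w : 'rV[R]_n -> R) (p q r t K : R).
Local Notation mu := (@lebesgue_row R n).

(** The function h of the outline: the share of the energy seen from the point [x]. *)
Let energy_section u (x : 'rV[R]_n) : \bar R :=
  (\int[mu]_(y in U) (gagliardo_kernel s u (x, y))%:E)%E.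

Let energy_section_ge0 u x : (0 <= energy_section u x)%E.
Proof. by apply: integral_ge0 => y _; rewrite lee_fin gagliardo_kernel_ge0. Qed.

Let measurable_kernel u : measurable_fun U u ->
  measurable_fun (U `*` U) (fun z => (gagliardo_kernel s u z)%:E).
Proof. by move=> mu_; apply/measurable_EFinP; exact: measurable_gagliardo_kernel. Qed.

Let energyE u : measurable_fun U u ->
  gagliardo_energy s U u = (\int[mu]_(x in U) energy_section u x)%E.
Proof.
move=> mu_; rewrite /gagliardo_energy ge0_integral_prod_set//.
- exact: measurable_kernel.
- by move=> z _; rewrite lee_fin gagliardo_kernel_ge0.
Qed.

Let measurable_energy_section u : measurable_fun U u ->
  measurable_fun U (energy_section u).
Proof.
move=> mu_.
have k0 z : (U `*` U) z -> (0 <= (gagliardo_kernel s u z)%:E)%E.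
  by move=> _; rewrite lee_fin gagliardo_kernel_ge0.
exact: (measurable_integral_prod_set mu mU mU (measurable_kernel mu_) k0).
Qed.

Let measurable_kernel_section u x : measurable_fun U u -> U x ->
  measurable_fun U (fun y => gagliardo_kernel s u (x, y)).
Proof.
move=> mu_ Ux.
apply: (measurable_comp (F := U `*` U) _ _ (measurable_gagliardo_kernel s mU mu_)).
- exact: measurableX.
- by move=> _ [y Uy <-].
- by apply: measurable_funTS; apply: measurable_fun_pair => //; exact: measurable_cst.
Qed.

Let measurable_power u p : measurable_fun U u -> measurable_fun U (fun y => `|u y| `^ p).
Proof.
by move=> mu_; apply: (measurableT_comp (@measurable_powR R p)); exact: measurableT_comp.
Qed.

(* The constant is v y for a generic y instead of the mean of v, which avoids
   integrability of v and lets y avoid any prescribed null set. *)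
Lemma poincare_point v t (P : set 'rV[R]_n) : measurable_fun U v -> 0 < t ->
  (gagliardo_energy s U v <= (t ^+ 2)%:E)%E ->
  {ae mu, forall x, U x -> P x} ->
  exists2 y, U y /\ P y &
    (power_integral 2 U (fun x => v x - v y)%R
      <= (2 * D `^ (n%:R + 2 * s) / V * t ^+ 2)%:E)%E.
Proof.
move=> mv t0 vt aeP.
pose A := D `^ (n%:R + 2 * s) * t ^+ 2.
have A0 : 0 < A by rewrite mulr_gt0 ?powR_gt0// exprn_gt0.
(* If no such y exists, the opposite strict inequality holds for almost every y; integrated over
   [U], it gives 2 A <= A through [gagliardo_kernel_lower] and Tonelli. *)
apply: contrapT => /forall2NP H.
have mF : measurable_fun U (fun y => (D `^ (n%:R + 2 * s))%:E * energy_section v y)%E.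
  apply: measurable_funeM; exact: measurable_energy_section.
have : (\int[mu]_(y in U) (2 * A / V)%:E <=
  \int[mu]_(y in U) ((D `^ (n%:R + 2 * s))%:E * energy_section v y))%E.
  apply: ae_ge0_le_integral => //.
  - move=> y _; rewrite lee_fin; apply: divr_ge0; last exact: ltW.
    by move: A0; lra.
  - by move=> y _; rewrite mule_ge0// lee_fin powR_ge0.
  - apply: filterS aeP => y PUy Uy; case: (H y) => [[]|/negP]; first by split=> //; exact: PUy.
    rewrite -ltNge => /ltW.
    rewrite (_ : 2 * _ / V * _ = 2 * A / V); last by rewrite /A; field; exact: lt0r_neq0.
    move/le_trans; apply; rewrite /energy_section -ge0_integralZl_EFin ?powR_ge0//; last 2 first.
    + by move=> z _; rewrite lee_fin gagliardo_kernel_ge0.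
    + by apply/measurable_EFinP; exact: measurable_kernel_section.
    apply: ge0_le_integral => //.
    + apply/measurable_EFinP; apply: measurable_power; apply: measurable_funB => //.
    + by apply: measurable_funeM; apply/measurable_EFinP; exact: measurable_kernel_section.
    move=> z Uz; rewrite -EFinM lee_fin powR_mulrn// real_normK ?num_real//.
    rewrite -[leLHS]sqrrN opprB; apply: (@gagliardo_kernel_lower _ _ s v D (y, z)) => //.
      exact: ltW.
    exact: UD.
rewrite (integral_cst mu mU) [X in (_ * X <= _)%E]UV ge0_integralZl_EFin ?powR_ge0//; last first.
  exact: measurable_energy_section.
rewrite -energyE// => /le_trans/(_ (lee_wpmul2l _ vt)).
rewrite lee_fin powR_ge0 => /(_ isT); rewrite -!EFinM lee_fin -/A mulfVK ?gt_eqF//.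
by move=> h; move: A0; lra.
Qed.

(* Chebyshev on U `&` ball x r: if no such y existed, the measure density bound
   would fail. *)
Lemma sobolev_point w p K x g r : 1 <= p -> 0 < K -> measurable_fun U w ->
  (power_integral p U w <= K%:E)%E -> U x -> 0 < g ->
  (energy_section w x <= g%:E)%E -> 0 < r <= c ->
  exists2 y, (w x - w y) ^+ 2 <= (4 * n%:R `^ (n%:R + 2 * s) / c) * r `^ (2 * s) * g
    & `|w y| `^ p <= 4 * K / c / r ^+ n.
Proof.
move=> p1 K0 mw wK Ux g0 wg rc; have r0 : 0 < r by case/andP: rc.
set a := _ * g; set b := _ / r ^+ n.
have nR : 0 < n%:R :> R by rewrite ltr0n.
have P0 : 0 < n%:R `^ (n%:R + 2 * s) :> R by rewrite powR_gt0.
have rs0 : 0 < r `^ (2 * s) by rewrite powR_gt0.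
have rn0 : 0 < r ^+ n by rewrite exprn_gt0.
have a0 : 0 < a by rewrite /a !mulr_gt0 ?invr_gt0.
have b0 : 0 < b by rewrite /b !mulr_gt0 ?invr_gt0.
apply: contrapT => /forall2NP H.
pose W := U `&` ball x r.
have mW : measurable W.
  by apply: measurableI => //; rewrite ball_box//; exact: measurable_box.
have WU : W `<=` U by move=> z [].
have mk : measurable_fun U (fun y => (gagliardo_kernel s w (x, y))%:E).
  by apply/measurable_EFinP; exact: measurable_kernel_section.
have mp : measurable_fun U (fun y => (`|w y| `^ p)%:E).
  by apply/measurable_EFinP; exact: measurable_power.
pose k1 := (n%:R * r) `^ (n%:R + 2 * s) / a.
have k10 : 0 <= k1 by rewrite divr_ge0 ?powR_ge0 ?ltW.
have b10 : 0 <= b^-1 by rewrite invr_ge0 ltW.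
(* At each y of [W] one of the two bounds fails, which makes one of these two terms at least 1. *)
have ge1 y : W y ->
    (1%:E <= k1%:E * (gagliardo_kernel s w (x, y))%:E + b^-1%:E * (`|w y| `^ p)%:E)%E.
  move=> [Uy /ball_rowP[_ xy]]; rewrite -!EFinM -EFinD lee_fin.
  case: (H y) => /negP; rewrite -ltNge => h.
    rewrite ler_wpDr ?mulr_ge0 ?powR_ge0// /k1 mulrAC ler_pdivlMr// mul1r.
    apply: le_trans (ltW h) _; apply: (@gagliardo_kernel_lower _ _ s w (n%:R * r) (x, y)) => //=.
      exact: ltW.
    by apply: euclidean_norm_le => [|i]; rewrite ?mxE ltW.
  apply: ler_wpDl; first by rewrite mulr_ge0// gagliardo_kernel_ge0.
  by rewrite mulrC ler_pdivlMr// mul1r ltW.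
have mk1 : measurable_fun W (fun y => k1%:E * (gagliardo_kernel s w (x, y))%:E)%E.
  by apply: measurable_funeM; exact: measurable_funS mk.
have mp1 : measurable_fun W (fun y => b^-1%:E * (`|w y| `^ p)%:E)%E.
  by apply: measurable_funeM; exact: measurable_funS mp.
have := dU Ux rc; apply/negP; rewrite -ltNge -/W.
rewrite -[ltLHS]mul1e -(integral_cst mu mW).
apply: (@le_lt_trans _ _ (\int[mu]_(y in W)
  (k1%:E * (gagliardo_kernel s w (x, y))%:E + b^-1%:E * (`|w y| `^ p)%:E))%E).
  by apply: ge0_le_integral => //; exact: emeasurable_funD.
have kp z : W z -> (0 <= (gagliardo_kernel s w (x, z))%:E)%E.
  by move=> _; rewrite lee_fin gagliardo_kernel_ge0.
have kp1 z : W z -> (0 <= k1%:E * (gagliardo_kernel s w (x, z))%:E)%E.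
  by move=> Wz; rewrite mule_ge0 ?kp.
have pp1 z : W z -> (0 <= b^-1%:E * (`|w z| `^ p)%:E)%E.
  by move=> Wz; rewrite mule_ge0// lee_fin powR_ge0.
have mkW := measurable_funS mU WU mk; have mpW := measurable_funS mU WU mp.
rewrite ge0_integralD// !ge0_integralZl_EFin//.
apply: (@le_lt_trans _ _ (k1%:E * g%:E + b^-1%:E * K%:E)%E).
  apply: leeD; apply: lee_wpmul2l; rewrite ?lee_fin//.
    apply: le_trans wg; apply: ge0_subset_integral => //.
    by move=> z _; rewrite lee_fin gagliardo_kernel_ge0.
  by apply: le_trans wK; exact: ge0_subset_integral.
rewrite -!EFinM -EFinD lte_fin.
(* The factors 4 in [a] and [b] make each term a quarter of c r^n, so that their sum stays below the
   density bound. *)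
have -> : k1 * g = c * r ^+ n / 4.
  rewrite /k1 /a powRM ?ler0n ?ltW// (@powRD _ r); last by rewrite (gt_eqF r0) implybT.
  rewrite powR_mulrn ?ltW//; field.
  by rewrite !gt_eqF.
have -> : b^-1 * K = c * r ^+ n / 4.
  by rewrite /b; field; rewrite !gt_eqF.
by have := mulr_gt0 c0 rn0; lra.
Qed.

(* The radius r = c g^(-be) balances the two bounds of sobolev_point. *)
Lemma sobolev_pointwise p K : 1 <= p -> 0 < K ->
  exists2 C, 0 < C & forall w x g, measurable_fun U w ->
    (power_integral p U w <= K%:E)%E -> U x -> 1 <= g ->
    (energy_section w x <= g%:E)%E ->
    `|w x| `^ (2 + 2 * s / n%:R * p) <= C * g.
Proof.
move=> p1 K0; pose N : R := n%:R.
have N0 : 0 < N by rewrite ltr0n.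
have p0 : 0 < p by exact: lt_le_trans p1.
have Nsp : 0 < N + s * p by rewrite addr_gt0// mulr_gt0.
(* These exponents solve 1 - 2 s be = 2 th and n be = th p: both bounds of [sobolev_point] then give
   the order g^th, with th (2 + 2 s p / n) = 1. *)
pose th := N / (2 * (N + s * p)); pose be := p / (2 * (N + s * p)).
pose a := 4 * N `^ (N + 2 * s) / c * c `^ (2 * s); pose b := 4 * K / c / c ^+ n.
have a0 : 0 < a by rewrite !mulr_gt0 ?invr_gt0 ?powR_gt0.
have b0 : 0 < b by rewrite !mulr_gt0 ?invr_gt0 ?exprn_gt0.
pose C := Num.sqrt a + b `^ p^-1.
have C0 : 0 < C by rewrite addr_gt0 ?sqrtr_gt0 ?powR_gt0.
exists (C `^ (2 + 2 * s / N * p)); first by rewrite powR_gt0.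
move=> w x g mw wK Ux g1 wg; have g0 : 0 < g by exact: lt_le_trans g1.
have be0 : 0 < be by rewrite divr_gt0 ?mulr_gt0.
have th0 : 0 < th by rewrite divr_gt0 ?mulr_gt0.
have gth0 : 0 < g `^ th by rewrite powR_gt0.
pose r := c * g `^ (- be).
have gbe0 : 0 < g `^ (- be) by rewrite powR_gt0.
(* Here 1 <= g keeps the radius in the admissible range. *)
have rc : 0 < r <= c.
  rewrite mulr_gt0//= ger_pMr// -(powRr0 g) ler_powR//.
  by rewrite oppr_le0 ltW.
have [y wxy wy] := sobolev_point p1 K0 mw wK Ux g0 wg rc.
have Ea : 4 * N `^ (N + 2 * s) / c * r `^ (2 * s) * g = (Num.sqrt a * g `^ th) ^+ 2.
  rewrite exprMn sqr_sqrtr ?(ltW a0)// -[g `^ th ^+ 2]powR_mulrn ?powR_ge0// -powRrM.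
  rewrite /r powRM ?(ltW c0) ?powR_ge0// -powRrM /a -!mulrA; do 4 congr (_ * _).
  rewrite -[X in _ * X]powRr1 ?(ltW g0)// -powRD ?(gt_eqF g0) ?implybT//.
  by congr powR; rewrite /be /th; field; rewrite gt_eqF.
have Eb : 4 * K / c / r ^+ n = b * g `^ (th * p).
  rewrite /r exprMn -[g `^ _ ^+ n]powR_mulrn ?powR_ge0// -powRrM -/N /b invfM mulrA.
  congr (_ * _); rewrite -powRN; congr powR.
  by rewrite /be /th; field; rewrite gt_eqF.
have wx : `|w x| <= C * g `^ th.
  apply: (@le_trans _ _ (`|w x - w y| + `|w y|)).
    by rewrite -[X in `|X|](subrK (w y)) ler_normD.
  rewrite /C mulrDl lerD//.
    rewrite -(@ler_pXn2r _ 2) ?nnegrE ?mulr_ge0 ?sqrtr_ge0 ?(ltW gth0)//.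
    by rewrite real_normK ?num_real// -Ea.
  rewrite -[leLHS]powRr1// -(divff (lt0r_neq0 p0)) powRrM.
  apply: le_trans (_ : (b * g `^ (th * p)) `^ p^-1 <= _).
    rewrite ge0_ler_powR ?nnegrE ?powR_ge0 ?invr_ge0 ?(ltW p0)//.
      by rewrite mulr_ge0 ?powR_ge0 ?(ltW b0).
    by rewrite -Eb.
  rewrite powRM ?powR_ge0 ?(ltW b0)// -(powRrM g) -mulrA divff ?mulr1//.
  exact: lt0r_neq0.
have thq : th * (2 + 2 * s / N * p) = 1.
  by rewrite /th; field; rewrite !gt_eqF.
apply: le_trans (_ : (C * g `^ th) `^ (2 + 2 * s / N * p) <= _).
  apply: ge0_ler_powR; rewrite ?nnegrE ?mulr_ge0 ?(ltW C0) ?powR_ge0//.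
  by rewrite addr_ge0// !mulr_ge0 ?invr_ge0 ?(ltW s0) ?(ltW N0) ?(ltW p0).
by rewrite powRM ?(ltW C0) ?powR_ge0// -(powRrM g) thq powRr1 ?(ltW g0).
Qed.

(** Integrates [sobolev_pointwise] with g = 1 + h x: the total is at most C (V + 1), the energy
    being at most 1. *)
Lemma sobolev_step p K : 1 <= p -> 0 < K ->
  exists2 C, 0 < C & forall w, measurable_fun U w ->
    (power_integral p U w <= K%:E)%E -> (gagliardo_energy s U w <= 1)%E ->
    (power_integral (2 + 2 * s / n%:R * p) U w <= C%:E)%E.
Proof.
move=> p1 K0; have [C C0 hC] := sobolev_pointwise p1 K0.
exists (C * (V + 1)); first by rewrite mulr_gt0// addr_gt0.
move=> w mw wK w1.
have me := measurable_energy_section mw.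
have e0 x : U x -> (0 <= energy_section w x)%E by [].
apply: (@le_trans _ _ (\int[mu]_(x in U) (C%:E * (1 + energy_section w x)))%E).
  apply: ge0_le_integral => //.
  - by apply/measurable_EFinP; exact: measurable_power.
  - by apply: measurable_funeM; exact: emeasurable_funD.
  move=> x Ux; have := @hC w x _ mw wK Ux.
  case: (energy_section w x) (energy_section_ge0 w x) => [k| |] //.
    rewrite lee_fin => k0 h; rewrite -EFinD -EFinM lee_fin; apply: h.
      by rewrite lerDl.
    by rewrite lee_fin lerDr.
  (* Where the energy section is infinite, the right side is +oo. *)
  by move=> _ _; rewrite addey// gt0_muley// leey.
rewrite ge0_integralZl_EFin ?(ltW C0)//; last 2 first.
- by move=> x Ux; rewrite adde_ge0.
- exact: emeasurable_funD.
rewrite ge0_integralD// (integral_cst mu mU) mul1e -energyE//.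
rewrite EFinM lee_wpmul2l ?lee_fin ?(ltW C0)// EFinD.
by rewrite [X in (X + _ <= _)%E]UV leeD.
Qed.

(** Pointwise |w|^q <= 1 + |w|^p, according to whether |w| <= 1; this replaces the Holder inequality
    for lowering the exponent. *)
Lemma power_integral_mono p q w : 0 <= q -> q <= p -> measurable_fun U w ->
  (power_integral q U w <= V%:E + power_integral p U w)%E.
Proof.
move=> q0 qp mw; rewrite -UV -[X in (X + _)%E]mul1e -(integral_cst mu mU).
have mP r : measurable_fun U (fun x => (`|w x| `^ r)%:E).
  by apply/measurable_EFinP; exact: measurable_power.
rewrite -ge0_integralD//; apply: ge0_le_integral => //.
  exact: emeasurable_funD.
move=> x Ux; rewrite -EFinD lee_fin.
have [w1|/ltW w1] := leP `|w x| 1.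
  apply: ler_wpDr; first exact: powR_ge0.
  have -> : 1 = 1 `^ q :> R by rewrite powR1.
  by rewrite ge0_ler_powR ?nnegrE.
by apply: ler_wpDl => //; exact: ler_powR.
Qed.

(** The increment 2 - (1 - 2 s / n) p is decreasing in p when 2 s < n, and positive at [q] since [q]
    is subcritical; when 2 s >= n it is at least 2. *)
Lemma subcritical_gap q : (q%:E < critical_exponent n s)%E ->
  exists2 d, 0 < d & forall p, 0 <= p <= q -> p + d <= 2 + 2 * s / n%:R * p.
Proof.
have N0 : 0 < n%:R :> R by rewrite ltr0n.
rewrite /critical_exponent; case: (ltP (2 * s) n%:R) => [sn|ns _]; last first.
  exists 2 => // p /andP[p0 _]; rewrite addrC lerD2l.
  by rewrite ler_peMl// ler_pdivlMr// mul1r.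
rewrite lte_fin ltr_pdivlMr ?subr_gt0// => qs.
exists (2 - (1 - 2 * s / n%:R) * q).
  rewrite subr_gt0 -(ltr_pM2r N0) (_ : _ * n%:R = q * (n%:R - 2 * s))//.
  by field; rewrite gt_eqF.
move=> p /andP[p0 pq]; have : (1 - 2 * s / n%:R) * p <= (1 - 2 * s / n%:R) * q.
  by rewrite ler_wpM2l// subr_ge0 ler_pdivrMr// mul1r ltW.
by lra.
Qed.

(* The map p |-> 2 + 2 s p / n has the critical exponent as its fixed point when
   2 s < n, and increases by at least d at each step below q. *)
Lemma sobolev_subcritical q K : 0 <= q -> (q%:E < critical_exponent n s)%E -> 0 < K ->
  exists2 C, 0 < C & forall w, measurable_fun U w ->
    (power_integral 2 U w <= K%:E)%E -> (gagliardo_energy s U w <= 1)%E ->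
    (power_integral q U w <= C%:E)%E.
Proof.
move=> q0 /subcritical_gap[d d0 hd] K0.
have [p [C [_ C0 qp hC]]] : exists p C, [/\ 2 <= p, 0 < C, q <= p &
    forall w, measurable_fun U w -> (power_integral 2 U w <= K%:E)%E ->
    (gagliardo_energy s U w <= 1)%E -> (power_integral p U w <= C%:E)%E].
  (* After k steps either [q] has been reached or p >= k d, so more than q / d steps suffice. *)
  have H (k : nat) : exists p C, [/\ 2 <= p, 0 < C, q <= p \/ k%:R * d <= p &
      forall w, measurable_fun U w -> (power_integral 2 U w <= K%:E)%E ->
      (gagliardo_energy s U w <= 1)%E -> (power_integral p U w <= C%:E)%E].
    elim: k => [|k [p [C [p2 C0 qp hC]]]].
      by exists 2, K; split=> //; right; rewrite mul0r.
    have [qp'|pq] := leP q p; first by exists p, C; split=> //; left.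
    have {}qp : k%:R * d <= p by case: qp => //; rewrite leNgt pq.
    have p1 : 1 <= p by apply: le_trans p2; rewrite ler1n.
    have [C' C'0 hC'] := sobolev_step p1 C0.
    have h := hd p; rewrite (ltW pq) andbT in h.
    exists (2 + 2 * s / n%:R * p), C'; split=> //.
    - by rewrite lerDl !mulr_ge0 ?invr_ge0 ?(ltW s0)//; lra.
    - by right; rewrite -natr1; lra.
    - by move=> w mw w2 w1; apply: hC' => //; exact: hC.
  have [p [C [p2 C0 qp hC]]] := H (Num.truncn (q / d)).+1.
  exists p, C; split=> //; case: qp => //; apply: le_trans.
  by rewrite -ler_pdivrMr// ltW// truncnS_gt.
exists (V + C); first by rewrite addr_gt0.
move=> w mw w2 w1; apply: le_trans (power_integral_mono q0 qp mw) _.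
by rewrite EFinD leeD2l// hC.
Qed.

Lemma power_integralZ r a w : 0 <= a -> measurable_fun U w ->
  power_integral r U (fun x => a * w x) = ((a `^ r)%:E * power_integral r U w)%E.
Proof.
move=> a0 mw; rewrite /power_integral -ge0_integralZl_EFin ?powR_ge0//; last first.
  by apply/measurable_EFinP; exact: measurable_power.
by apply: eq_integral => x _; rewrite -EFinM normrM (ger0_norm a0) powRM.
Qed.

Lemma gagliardo_energyZ a b w : measurable_fun U w ->
  gagliardo_energy s U (fun x => a * (w x - b)) =
  ((a ^+ 2)%:E * gagliardo_energy s U w)%E.
Proof.
move=> mw; rewrite /gagliardo_energy -ge0_integralZl_EFin ?sqr_ge0//.
- apply: eq_integral => z _; rewrite -EFinM; congr EFin.
  by rewrite /gagliardo_kernel mulrA -exprMn; congr (_ ^+ 2 / _); ring.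
- exact: measurableX.
- by move=> z _; rewrite lee_fin gagliardo_kernel_ge0.
- exact: measurable_kernel.
Qed.

Lemma Lr_norm_le r C t w : 0 < r -> 0 <= t -> 0 <= C ->
  (power_integral r U w <= (t `^ r * C)%:E)%E ->
  (Lr_norm r U w <= (C `^ r^-1 * t)%:E)%E.
Proof.
move=> r0 t0 C0 h; rewrite Lr_normE ?gt_eqF//.
have -> : (C `^ r^-1 * t)%:E = ((t `^ r * C)%:E `^ r^-1)%E.
  rewrite poweR_EFin powRM ?powR_ge0// -powRrM divff ?gt_eqF// powRr1//.
  by rewrite mulrC.
rewrite gt0_ler_poweR ?invr_ge0 ?(ltW r0)// !in_itv/= leey andbT.
  exact: power_integral_ge0.
by rewrite lee_fin mulr_ge0// powR_ge0.
Qed.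

(** The normalised difference (v - v y) / t has energy at most 1 and bounded L^2 norm, so
    [sobolev_subcritical] applies, and homogeneity restores [t]. The same [y] serves both norms;
    leaving [t] free and positive covers the case of zero energy. *)
Lemma poincare_sobolev q : 1 <= q -> (q%:E < critical_exponent n s)%E ->
  exists2 C, 0 < C & forall v t (P : set 'rV[R]_n), measurable_fun U v -> 0 < t ->
    (gagliardo_energy s U v <= (t ^+ 2)%:E)%E ->
    {ae mu, forall x, U x -> P x} ->
    exists2 y, U y /\ P y &
      (Lr_norm 2 U (fun x => v x - v y)%R <= (C * t)%:E)%E /\
      (Lr_norm q U (fun x => v x - v y)%R <= (C * t)%:E)%E.
Proof.
move=> q1 qs; have q0 : 0 < q by exact: lt_le_trans q1.
pose K := 2 * D `^ (n%:R + 2 * s) / V.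
have K0 : 0 < K by rewrite divr_gt0// mulr_gt0// powR_gt0.
have [C C0 hC] := sobolev_subcritical (ltW q0) qs K0.
exists (K `^ 2^-1 + C `^ q^-1); first by rewrite addr_gt0 ?powR_gt0.
move=> v t P mv t0 vt aeP.
have [y UPy hy] := poincare_point mv t0 vt aeP.
exists y => //.
have mvy : measurable_fun U (fun x => v x - v y) by exact: measurable_funB.
pose w x := t^-1 * (v x - v y).
have mw : measurable_fun U w by exact: measurable_funM.
have ti0 : 0 <= t^-1 by rewrite invr_ge0 ltW.
have w2 : (power_integral 2 U w <= K%:E)%E.
  rewrite power_integralZ// powR_mulrn//.
  apply: le_trans (lee_wpmul2l _ hy) _; first by rewrite lee_fin sqr_ge0.
  rewrite -EFinM lee_fin -/K mulrCA -exprMn mulVf ?gt_eqF// expr1n mulr1.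
  exact: lexx.
have w1 : (gagliardo_energy s U w <= 1)%E.
  rewrite gagliardo_energyZ//.
  apply: le_trans (lee_wpmul2l _ vt) _; first by rewrite lee_fin sqr_ge0.
  by rewrite -EFinM lee_fin -exprMn mulVf ?gt_eqF// expr1n.
have wE r : power_integral r U (fun x => v x - v y) =
    ((t `^ r)%:E * power_integral r U w)%E.
  rewrite -power_integralZ ?(ltW t0)//; congr power_integral; apply/funext => x.
  by rewrite /w mulrA divff ?mul1r// gt_eqF.
have tr r : (0 <= (t `^ r)%:E)%E by rewrite lee_fin powR_ge0.
split.
  apply: le_trans (Lr_norm_le (C := K) (t := t) _ _ _ _) _; rewrite ?(ltW t0) ?(ltW K0)//.
    by rewrite wE EFinM lee_wpmul2l.
  by rewrite lee_fin mulrDl lerDl mulr_ge0 ?powR_ge0 ?(ltW t0).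
apply: le_trans (Lr_norm_le (C := C) (t := t) _ _ _ _) _; rewrite ?(ltW t0) ?(ltW C0)//.
  by rewrite wE EFinM lee_wpmul2l// hC.
by rewrite lee_fin mulrDl lerDr mulr_ge0 ?powR_ge0 ?(ltW t0).
Qed.

End embedding.

(** * Dilations *)

Section bounded_open.
Context {R : realType} {n : nat}.
Variable U : set 'rV[R]_n.

Lemma lebesgue_row_bounded_open : open U -> bounded_set U -> U !=set0 ->
  exists2 V, 0 < V & lebesgue_row n U = V%:E.
Proof.
move=> oU /bounded_coord[M M0 UM] [x Ux].
have mU := open_measurable_row oU.
have mball (z : 'rV[R]_n) r : 0 < r -> measurable (ball z r).
  by move=> r0; rewrite ball_box//; exact: measurable_box.
have fin : (lebesgue_row n U < +oo)%E.
  apply: (@le_lt_trans _ _ (lebesgue_row n (ball (0 : 'rV[R]_n) (M + 1)))).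
    apply: le_measure; rewrite ?inE//; first by apply: mball; lra.
    move=> y Uy; apply/ball_rowP; split=> [|i]; first lra.
    by rewrite mxE sub0r normrN; have := UM _ Uy i; lra.
  by rewrite lebesgue_row_ball ?ltry//; lra.
have /nbhs_ballP[r/= r0 hr] : nbhs x U by exact: open_nbhs_nbhs.
have pos : (0 < lebesgue_row n U)%E.
  apply: (@lt_le_trans _ _ (lebesgue_row n (ball x r))).
    by rewrite lebesgue_row_ball// lte_fin exprn_gt0// mulr_gt0.
  by apply: le_measure; rewrite ?inE//; exact: mball.
exists (fine (lebesgue_row n U)); first by rewrite fine_gt0// pos fin.
by rewrite fineK// ge0_fin_numE.
Qed.

Lemma euclidean_bounded : (0 < n)%N -> bounded_set U ->
  exists2 D, 0 < D & forall x y, U x -> U y -> euclidean_norm (x - y) <= D.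
Proof.
move=> n0 /bounded_coord[M M0 UM]; exists (n%:R * (2 * M)).
  by rewrite !mulr_gt0// ltr0n.
move=> x y Ux Uy; apply: euclidean_norm_le => [|i]; first lra.
rewrite !mxE; apply: le_trans (ler_normB _ _) _.
by have := UM _ Ux i; have := UM _ Uy i; lra.
Qed.

End bounded_open.

Section scaling.
Context {R : realType} {n : nat}.
Variables (U : set 'rV[R]_n) (e : R).
Hypotheses (mU : measurable U) (e0 : 0 < e).
Implicit Types (u : 'rV[R]_n -> R) (r s : R).
Local Notation mu := (@lebesgue_row R n).

Lemma scale_setE : scale_set e U = (fun x => e^-1 *: x) @^-1` U.
Proof.
apply/seteqP; split=> x /=.
  by move=> [y Uy <-]; rewrite scalerA mulVf ?scale1r// gt_eqF.
move=> Ux; exists (e^-1 *: x) => //.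
by rewrite scalerA divff ?scale1r// gt_eqF.
Qed.

Lemma scale_set_scale x : scale_set e U (e *: x) = U x.
Proof. by rewrite scale_setE /= scalerA mulVf ?scale1r// gt_eqF. Qed.

Lemma measurable_scale_set : measurable (scale_set e U).
Proof.
rewrite scale_setE -[X in measurable X]setTI.
exact: (@measurable_row_scale R n e^-1).
Qed.

Lemma ge0_integral_scale_set (f : 'rV[R]_n -> \bar R) :
  measurable_fun (scale_set e U) f ->
  (forall x, scale_set e U x -> 0 <= f x)%E ->
  (\int[mu]_(x in scale_set e U) f x =
    (e ^+ n)%:E * \int[mu]_(x in U) f (e *: x))%E.
Proof.
move=> mf f0; rewrite integral_mkcond.
have mg : measurable_fun setT (f \_ (scale_set e U)).
  by apply/(measurable_restrictT _ _).1 => //; exact: measurable_scale_set.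
have g0 x : (0 <= (f \_ (scale_set e U)) x)%E by apply: erestrict_ge0.
have -> : (\int[mu]_(x in U) f (e *: x) =
    \int[mu]_x (f \_ (scale_set e U)) (e *: x))%E.
  rewrite integral_mkcond; apply: eq_integral => x _; rewrite !patchE.
  by congr (if _ then _ else _); apply/idP/idP; rewrite !inE scale_set_scale.
rewrite ge0_integral_row_scale// muleA -EFinM divff ?mul1e//.
by rewrite expf_eq0 gt_eqF ?andbF.
Qed.

Lemma measurable_fun_scale u : measurable_fun (scale_set e U) u ->
  measurable_fun U (fun x => u (e *: x)).
Proof.
move=> mu_; apply: (measurable_comp measurable_scale_set _ mu_).
  by move=> _ [x Ux <-]; rewrite scale_set_scale.
by apply: measurable_funTS; exact: measurable_row_scale.
Qed.

Lemma power_integral_scale r u : measurable_fun (scale_set e U) u ->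
  power_integral r (scale_set e U) u =
  ((e ^+ n)%:E * power_integral r U (fun x => u (e *: x)%R))%E.
Proof.
move=> mu_; rewrite /power_integral ge0_integral_scale_set//.
apply/measurable_EFinP; apply: (measurableT_comp (@measurable_powR R r)).
exact: measurableT_comp.
Qed.

(** Each variable contributes e^n and the kernel e^(-n-2s), whence e^(n-2s) in total. *)
Lemma gagliardo_energy_scale s u : measurable_fun (scale_set e U) u ->
  gagliardo_energy s (scale_set e U) u =
  ((e ^+ n * e `^ (- (2 * s)))%:E
    * gagliardo_energy s U (fun x => u (e *: x)%R))%E.
Proof.
move=> mu_; have mv := measurable_fun_scale mu_.
have mS := measurable_scale_set.
have k0 w (A : set 'rV[R]_n) z : (A `*` A) z -> (0 <= (gagliardo_kernel s w z)%:E)%E.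
  by move=> _; rewrite lee_fin gagliardo_kernel_ge0.
have mk w (A : set 'rV[R]_n) : measurable A -> measurable_fun A w ->
    measurable_fun (A `*` A) (fun z => (gagliardo_kernel s w z)%:E).
  by move=> mA mw; apply/measurable_EFinP; exact: measurable_gagliardo_kernel.
rewrite /gagliardo_energy !ge0_integral_prod_set//; do ?[exact: mk|exact: k0].
rewrite ge0_integral_scale_set; last 2 first.
- exact: (measurable_integral_prod_set mu mS mS (mk _ _ mS mu_) (k0 _ _)).
- by move=> x _; apply: integral_ge0 => y _; rewrite lee_fin gagliardo_kernel_ge0.
rewrite EFinM -muleA; congr (_ * _)%E.
rewrite -ge0_integralZl_EFin ?powR_ge0//; last 2 first.
- by move=> x _; apply: integral_ge0 => y _; rewrite lee_fin gagliardo_kernel_ge0.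
- exact: (measurable_integral_prod_set mu mU mU (mk _ _ mU mv) (k0 _ _)).
apply: eq_integral => x; rewrite inE => Ux.
have section_measurable w (A : set 'rV[R]_n) z : measurable A -> measurable_fun A w ->
    A z -> measurable_fun A (fun y => (gagliardo_kernel s w (z, y))%:E).
  move=> mA mw Az; apply: (measurable_comp (F := A `*` A) _ _ (mk _ _ mA mw)).
  - exact: measurableX.
  - by move=> _ [y Ay <-].
  - by apply: measurable_funTS; apply: measurable_fun_pair => //; exact: measurable_cst.
rewrite ge0_integral_scale_set; last 2 first.
- by apply: section_measurable => //; rewrite scale_set_scale.
- by move=> y _; rewrite lee_fin gagliardo_kernel_ge0.
have en : e ^+ n != 0 by rewrite expf_eq0 gt_eqF ?andbF.
(* The kernel factor is split as e^(-n) e^(-2s), the first cancelling the inner Jacobian. *)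
transitivity ((e ^+ n)%:E * \int[mu]_(y in U) ((e ^- n * e `^ (- (2 * s)))%:E *
    (gagliardo_kernel s (fun x => u (e *: x)) (x, y))%:E))%E; last first.
  rewrite ge0_integralZl_EFin; first by rewrite muleA -EFinM mulrA divff ?mul1r.
  - exact: mU.
  - by move=> y _; rewrite lee_fin gagliardo_kernel_ge0.
  - exact: section_measurable.
  - by rewrite mulr_ge0 ?powR_ge0// invr_ge0 exprn_ge0// ltW.
congr (_ * _)%E; apply: eq_integral => y _; rewrite -!EFinM; congr EFin.
rewrite /gagliardo_kernel /= -scalerBr euclidean_norm_scale ?(ltW e0)//.
rewrite powRM ?(ltW e0) ?euclidean_norm_ge0// [e `^ (_ + _)]powRD ?(gt_eqF e0) ?implybT//.
rewrite powR_mulrn ?(ltW e0)// powRN !invfM.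
by rewrite mulrCA.
Qed.

End scaling.

(** * Functions of small energy *)

Section Lr_norm_theory.
Context {R : realType} {n : nat}.
Variable U : set 'rV[R]_n.
Hypothesis mU : measurable U.
Implicit Types (u v : 'rV[R]_n -> R) (r s a b : R).
Local Notation mu := (@lebesgue_row R n).

Lemma Lr_norm_ge0 r u : (0 <= Lr_norm r U u)%E.
Proof. exact: Lnorm_ge0. Qed.

Lemma minkowski_Lr_norm r u v : 1 <= r -> measurable_fun U u -> measurable_fun U v ->
  (Lr_norm r U (fun x => u x + v x)%R <= Lr_norm r U u + Lr_norm r U v)%E.
Proof.
move=> r1 mu_ mv; rewrite /Lr_norm.
have -> : (fun x => u x + v x) \_ U = ((u \_ U) \+ (v \_ U))%R.
  apply/funext => x; rewrite /= !patchE; case: ifP => // _.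
  by rewrite (_ : point = 0 :> R)// addr0.
by apply: minkowski_EFin => //; apply/(measurable_restrictT _ _).1.
Qed.

Lemma eq_Lr_norm_normr r u v : (forall x, `|u x| = `|v x|) ->
  r != 0 -> Lr_norm r U u = Lr_norm r U v.
Proof.
by move=> uv r0; rewrite !Lr_normE//; congr poweR; apply: eq_integral => x _; rewrite uv.
Qed.

Lemma Lr_norm_cst r a (V : R) : 0 < r -> 0 < V -> mu U = V%:E ->
  Lr_norm r U (cst a) = (`|a| * V `^ r^-1)%:E.
Proof.
move=> r0 V0 UV; rewrite Lr_normE ?gt_eqF//.
have -> : power_integral r U (cst a) = ((`|a| `^ r)%:E * mu U)%E.
  exact: (integral_cst mu mU (`|a| `^ r)%:E).
rewrite UV -EFinM poweR_EFin powRM ?powR_ge0 ?(ltW V0)//.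
by rewrite -powRrM divff ?gt_eqF// powRr1.
Qed.

Lemma Lr_norm2_sqr u : (Lr_norm 2 U u ^+ 2 = power_integral 2 U u)%E.
Proof. by rewrite Lr_normE ?pnatr_eq0// poweR_half_sqr// power_integral_ge0. Qed.

Lemma Hs_norm_sqr s u :
  (Hs_norm s U u ^+ 2 = gagliardo_energy s U u + power_integral 2 U u)%E.
Proof.
rewrite /Hs_norm gagliardo_sqr Lr_norm2_sqr poweR_half_sqr// adde_ge0//.
  exact: gagliardo_energy_ge0.
exact: power_integral_ge0.
Qed.

Lemma Hs_fin s u : Hs s U u -> exists g a : R, [/\ 0 <= g, 0 <= a,
  gagliardo_energy s U u = (g ^+ 2)%:E & power_integral 2 U u = (a ^+ 2)%:E].
Proof.
case=> _ u2 us.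
have fin (x : \bar R) : (0 <= x -> x < +oo -> exists2 r : R, (0 <= r)%R & x ^+ 2 = (r ^+ 2)%:E)%E.
  by case: x => [r| |]// r0 _; exists r.
have [g g0 ge] := fin _ (gagliardo_ge0 s U u) us.
have [a a0 ae] := fin _ (Lr_norm_ge0 2 u) u2.
by exists g, a; split=> //; [rewrite -gagliardo_sqr|rewrite -Lr_norm2_sqr].
Qed.

End Lr_norm_theory.

Section rigidity.
Context {R : realType} {n : nat}.
Variables (U : set 'rV[R]_n) (s q V C : R).
Hypotheses (mU : measurable U) (V0 : 0 < V) (C0 : 0 < C) (q1 : 1 <= q).
Hypothesis UV : lebesgue_row n U = V%:E.
Hypothesis PS : forall v t (P : set 'rV[R]_n), measurable_fun U v -> 0 < t ->
  (gagliardo_energy s U v <= (t ^+ 2)%:E)%E ->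
  {ae lebesgue_row n, forall x, U x -> P x} ->
  exists2 y, U y /\ P y &
    (Lr_norm 2 U (fun x => v x - v y)%R <= (C * t)%:E)%E /\
    (Lr_norm q U (fun x => v x - v y)%R <= (C * t)%:E)%E.
Implicit Types (v : 'rV[R]_n -> R).

Let q0 : 0 < q. Proof. exact: lt_le_trans q1. Qed.
(** The ratio of the L^q and L^2 norms of a nonzero constant on [U]. *)
Let W := V `^ q^-1 / V `^ 2^-1.
Let Vq0 : 0 < V `^ q^-1. Proof. exact: powR_gt0. Qed.
Let V20 : 0 < V `^ 2^-1. Proof. exact: powR_gt0. Qed.

Let mean_norm r v m (x y : R) : 1 <= r -> measurable_fun U v ->
  (Lr_norm r U v <= x%:E)%E -> (Lr_norm r U (fun x => v x - m)%R <= y%:E)%E ->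
  `|m| * V `^ r^-1 <= x + y.
Proof.
move=> r1 mv vx vy; have r0 : 0 < r by exact: lt_le_trans r1.
rewrite -lee_fin -(Lr_norm_cst mU m r0 V0 UV).
have mvm : measurable_fun U (fun x => m - v x) by exact: measurable_funB.
have -> : cst m = (fun x => v x + (m - v x)) by apply/funext => z /=; ring.
apply: le_trans (minkowski_Lr_norm mU r1 mv mvm) _.
rewrite EFinD leeD// (eq_Lr_norm_normr mU (v := fun x => v x - m)) ?gt_eqF//.
by move=> z; rewrite distrC.
Qed.

Let norm_mean r v m (y : R) : 1 <= r -> measurable_fun U v ->
  (Lr_norm r U (fun x => v x - m)%R <= y%:E)%E ->
  (Lr_norm r U v <= (y + `|m| * V `^ r^-1)%:E)%E.
Proof.
move=> r1 mv vy; have r0 : 0 < r by exact: lt_le_trans r1.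
have mvm : measurable_fun U (fun x => v x - m) by exact: measurable_funB.
have -> : v = (fun x => (v x - m) + cst m x) by apply/funext => z /=; ring.
apply: le_trans (minkowski_Lr_norm mU r1 mvm (measurable_cst _)) _.
rewrite EFinD leeD ?(Lr_norm_cst mU m r0 V0 UV)//.
Qed.

(** Triangle inequality in L^q about the constant m = v y given by [PS]: |v|_q <= C t + |m| V^(1/q),
    while |m| V^(1/2) <= a + C t in L^2, and [W] converts one norm of the constant into the
    other. *)
Lemma Lr_norm_le_energy v (g a : R) : measurable_fun U v -> 0 <= g -> 0 <= a ->
  gagliardo_energy s U v = (g ^+ 2)%:E -> power_integral 2 U v = (a ^+ 2)%:E ->
  (Lr_norm q U v <= (W * a + (C * (1 + W)) * g)%:E)%E.
Proof.
move=> mv g0 a0 vg va; have W0 : 0 < W by rewrite divr_gt0.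
have C1 : 0 < C * (1 + W) by rewrite mulr_gt0// addr_gt0.
apply/lee_addgt0Pr => h h0.
(* [PS] requires t > 0 although [g] may vanish; the excess is tuned to cost exactly [h]. *)
pose t := g + h / (C * (1 + W)).
have t0 : 0 < t by rewrite ltr_wpDl// divr_gt0.
have gt : (gagliardo_energy s U v <= (t ^+ 2)%:E)%E.
  by rewrite vg lee_fin ler_pXn2r ?nnegrE ?(ltW t0)// lerDl ltW// divr_gt0.
have [y _ [y2 yq]] := PS (P := setT) mv t0 gt (nearW _ (fun _ _ => I)).
have v2 : (Lr_norm 2 U v <= a%:E)%E.
  rewrite Lr_normE ?pnatr_eq0// va poweR_EFin powR12_sqrt ?sqr_ge0// sqrtr_sqr.
  by rewrite ger0_norm.
have m2 := mean_norm (ler1n R 2) mv v2 y2.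
apply: le_trans (norm_mean q1 mv yq) _; rewrite -EFinD lee_fin.
have -> : W * a + C * (1 + W) * g + h = C * t + W * (a + C * t).
  rewrite -[h in LHS](divfK (lt0r_neq0 C1)) /t.
  by move: (h / _) => d; ring.
rewrite lerD2l; apply: le_trans (ler_wpM2l (ltW W0) m2).
by rewrite /W mulrCA divfK// gt_eqF.
Qed.

(** As |v|_q = 1, the triangle inequality puts |m| V^(1/q) within C t of 1, so v is close to m and
    |m| to V^(-1/q). The sign turns m into |m|. *)
Lemma Hs_norm_near_constant v m (t : R) : measurable_fun U v -> 0 < t ->
  Lr_norm q U v = 1%E ->
  (gagliardo_energy s U v <= (t ^+ 2)%:E)%E ->
  (Lr_norm 2 U (fun x => v x - m)%R <= (C * t)%:E)%E ->
  (Lr_norm q U (fun x => v x - m)%R <= (C * t)%:E)%E ->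
  (Hs_norm s U (fun x => (-1) ^+ (m < 0)%R * v x - V `^ (- q^-1))%R
    <= ((1 + C * (1 + W^-1)) * t)%:E)%E.
Proof.
move=> mv t0 v1 vt m2 mq.
set sg : R := (-1) ^+ (m < 0)%R; set k := V `^ (- q^-1).
have sg2 : sg ^+ 2 = 1 by rewrite sqrr_sign.
have Wi0 : 0 < W^-1 by rewrite invr_gt0 divr_gt0.
have Ct : 0 < C * t by exact: mulr_gt0.
have mk : `| `|m| - k| <= C * t * k.
  have := mean_norm (x := 1) q1 mv _ mq; rewrite v1 => /(_ (lexx _)) h1.
  have := norm_mean q1 mv mq; rewrite v1 lee_fin => h2.
  have kE : V `^ q^-1 * k = 1 by rewrite /k powRN divff ?gt_eqF.
  have k0 : 0 < k by rewrite powR_gt0.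
  have -> : `|m| - k = (`|m| * V `^ q^-1 - 1) * k by rewrite mulrBl -mulrA kE; ring.
  rewrite normrM (gtr0_norm k0) ler_pM2r// ler_norml; apply/andP; split; lra.
have mvm : measurable_fun U (fun x => sg * (v x - m)).
  by apply: measurable_funM => //; exact: measurable_funB.
have L2 : (Lr_norm 2 U (fun x => sg * v x - k)%R <= (C * (1 + W^-1) * t)%:E)%E.
  have -> : (fun x => sg * v x - k) = (fun x => sg * (v x - m) + cst (`|m| - k) x).
    apply/funext => x /=; have -> : `|m| = sg * m by exact: normrEsign.
    by ring.
  apply: le_trans (minkowski_Lr_norm mU (ler1n R 2) mvm (measurable_cst _)) _.
  (* The first term is the distance from v to m, the second bounds the L^2 norm of the constant |m|
     - k. *)
  have -> : C * (1 + W^-1) * t = C * t + C * t * k * V `^ 2^-1.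
    have -> : W^-1 = k * V `^ 2^-1 by rewrite /W /k powRN invf_div mulrC.
    by ring.
  rewrite EFinD leeD//.
    rewrite (eq_Lr_norm_normr mU (v := fun x => v x - m)) ?pnatr_eq0// => x.
    by rewrite normrM /sg normrX normrN1 expr1n mul1r.
  by rewrite (Lr_norm_cst mU _ _ V0 UV)// lee_fin ler_wpM2r// powR_ge0.
have E1 : (gagliardo_energy s U (fun x => sg * v x - k)%R <= (t ^+ 2)%:E)%E.
  (* The energy is blind to the sign and to added constants. *)
  have -> : (fun x => sg * v x - k) = (fun x => sg * (v x - sg * k)).
    by apply/funext => x; rewrite mulrBr mulrA -expr2 sg2 mul1r.
  by rewrite gagliardo_energyZ// sg2 mul1e.
have tC : 0 <= C * (1 + W^-1) * t by rewrite !mulr_ge0 ?(ltW t0) ?(ltW C0)// addr_ge0 ?(ltW Wi0).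
have -> : ((1 + C * (1 + W^-1)) * t)%:E = (((((1 + C * (1 + W^-1)) * t) ^+ 2)%:E) `^ 2^-1)%E.
  rewrite poweR_EFin powR12_sqrt ?sqr_ge0// sqrtr_sqr ger0_norm//.
  by rewrite mulrDl mul1r addr_ge0 ?(ltW t0).
have in0 (x : \bar R) : (0 <= x)%E -> x \in `[0%E, +oo%E].
  by move=> x0; rewrite in_itv/= x0 leey.
apply: gt0_ler_poweR; rewrite ?invr_ge0//; try apply: in0.
- rewrite gagliardo_sqr Lr_norm2_sqr// adde_ge0//.
    exact: gagliardo_energy_ge0.
  exact: power_integral_ge0.
- by rewrite lee_fin sqr_ge0.
rewrite gagliardo_sqr.
have L22 : (Lr_norm 2 U (fun x => sg * v x - k)%R ^+ 2 <= ((C * (1 + W^-1) * t) ^+ 2)%:E)%E.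
  by rewrite EFin_expe !expe2; apply: lee_pmul; rewrite ?Lr_norm_ge0.
apply: le_trans (leeD E1 L22) _; rewrite -EFinD lee_fin mulrDl mul1r sqrrD.
by move: (C * (1 + W^-1) * t) tC => z z0; rewrite addrAC lerDl mulrn_wge0// mulr_ge0// ltW.
Qed.

End rigidity.

(** * The rescaled quotient *)

Lemma Lr_norm_eq0 (R : realType) n (U : set 'rV[R]_n) (r : R) u :
  measurable U -> 0 < r -> measurable_fun U u -> Lr_norm r U u = 0%E ->
  {ae lebesgue_row n, forall x, U x -> u x = 0}.
Proof.
move=> mU r0 mu_ /Lnorm_eq0_eq0 H.
have mE : measurable_fun setT (EFin \o (u \_ U)).
  by apply/measurable_EFinP; apply/(measurable_restrictT _ _).1.
have := H mE; rewrite lte_fin => /(_ r0).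
apply: filterS => x /(_ I) /= + Ux; rewrite patchE mem_set// => h.
exact: EFin_inj h.
Qed.

Section quotient_scaling.
Context {R : realType} {n : nat}.
Variables (U : set 'rV[R]_n) (e s q : R).
Hypotheses (mU : measurable U) (e0 : 0 < e) (q0 : 0 < q).
Variable u : 'rV[R]_n -> R.
Let S := scale_set e U.
Let v x := u (e *: x).

Lemma Lr_norm_scale : measurable_fun S u ->
  Lr_norm q S u = ((e `^ (n%:R / q))%:E * Lr_norm q U v)%E.
Proof.
move=> mu_; rewrite !Lr_normE ?gt_eqF//; last exact: measurable_scale_set.
rewrite power_integral_scale// poweRM ?power_integral_ge0//; last first.
  by rewrite lee_fin exprn_ge0// ltW.
by rewrite poweR_EFin -powR_mulrn ?(ltW e0)// -powRrM.
Qed.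

(** Finiteness on the dilated set passes to [v] because the scaling factors are positive; the roots
    [g] and [a] make the later estimates inequalities between reals. *)
Lemma Hs_scale_fin : Hs s S u -> exists g a : R, [/\ 0 <= g, 0 <= a,
  gagliardo_energy s U v = (g ^+ 2)%:E & power_integral 2 U v = (a ^+ 2)%:E].
Proof.
move=> Hu; have [mu_ _ _] := Hu.
have [g [a [_ _]]] := Hs_fin (measurable_scale_set mU e0) Hu.
have en : 0 < e ^+ n by rewrite exprn_gt0.
have root (c x : R) (X : \bar R) : 0 < c -> (0 <= X -> c%:E * X = (x ^+ 2)%:E ->
    exists2 y : R, (0 <= y)%R & X = (y ^+ 2)%:E)%E.
  move=> c0; case: X => [X| |]//; last first.
    by move=> _; rewrite gt0_muley.
  rewrite lee_fin => X0 _; exists (Num.sqrt X); first exact: sqrtr_ge0.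
  by rewrite sqr_sqrtr.
rewrite gagliardo_energy_scale// power_integral_scale//.
move=> /root[|//|g' g'0 ge]; first by rewrite mulr_gt0// powR_gt0.
  exact: gagliardo_energy_ge0.
move=> /root[//||a' a'0 ae]; first exact: power_integral_ge0.
by exists g', a'.
Qed.

(** The common factor e^n of the numerator, divided by the e^(2n/q) of the denominator, is the
    normalisation of the theorem; only the energy keeps an extra e^(-2s). *)
Lemma sobolev_quotient_scale (g a N : R) : measurable_fun S u ->
  gagliardo_energy s U v = (g ^+ 2)%:E -> power_integral 2 U v = (a ^+ 2)%:E ->
  Lr_norm q U v = N%:E -> 0 < N ->
  sobolev_quotient s q S u =
  (e `^ (n%:R * (1 - 2 / q)) * ((e `^ (- (2 * s)) * g ^+ 2 + a ^+ 2) / N ^+ 2))%:E.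
Proof.
move=> mu_ vg va vN N0; rewrite /sobolev_quotient Hs_norm_sqr; last exact: measurable_scale_set.
rewrite gagliardo_energy_scale// power_integral_scale// Lr_norm_scale// vg va vN.
have en : 0 < e `^ (n%:R / q) by rewrite powR_gt0.
rewrite -!EFinM -EFinD -EFin_expe inver gt_eqF ?exprn_gt0 ?mulr_gt0// -EFinM.
congr EFin.
have -> : e `^ (n%:R * (1 - 2 / q)) = e ^+ n / e `^ (n%:R / q) ^+ 2.
  rewrite -(powR_mulrn n (ltW e0)) -(powR_mulrn 2 (powR_ge0 _ _)) -powRrM -powRN.
  rewrite -powRD ?(gt_eqF e0) ?implybT//; congr powR; ring.
by rewrite exprMn invfM; ring.
Qed.

Lemma Hs_nonzero_Lr_norm_gt0 : Hs_nonzero s S u -> (0 < Lr_norm q U v)%E.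
Proof.
move=> [[mu_ _ _] nz]; rewrite lt_def Lr_norm_ge0 andbT; apply/eqP => v0.
apply: nz; apply: (Lr_norm_eq0 (r := q) _ q0 mu_).
  exact: measurable_scale_set.
by rewrite Lr_norm_scale// v0 mule0.
Qed.

End quotient_scaling.

(** The constant 1 is the test function: its energy is zero, and its norms are explicit powers of
    [V]. *)
Lemma sobolev_constant_scale_le (R : realType) n (U : set 'rV[R]_n) (e s q V : R) :
  measurable U -> 0 < e -> 0 < q -> 0 < V -> lebesgue_row n U = V%:E ->
  (sobolev_constant s q (scale_set e U)
    <= (e `^ (n%:R * (1 - 2 / q)) * V `^ (1 - 2 / q))%:E)%E.
Proof.
move=> mU e0 q0 V0 UV; pose one : 'rV[R]_n -> R := cst 1.
have mS := measurable_scale_set mU e0.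
have m1 : measurable_fun (scale_set e U) one by exact: measurable_cst.
have energy0 A : gagliardo_energy s A one = (0 ^+ 2)%:E.
  rewrite expr0n/= /gagliardo_energy integral0_eq// => z _.
  by rewrite /gagliardo_kernel /one /= subrr expr0n/= mul0r.
have c1 r : 0 < r -> Lr_norm r U one = (V `^ r^-1)%:E.
  by move=> r0; rewrite (Lr_norm_cst mU 1 r0 V0 UV) normr1 mul1r.
have i2 : power_integral 2 U one = (Num.sqrt V ^+ 2)%:E.
  by rewrite -Lr_norm2_sqr// c1// -EFin_expe powR12_sqrt// ltW.
apply: ereal_inf_lbound; exists one; last first.
  rewrite (sobolev_quotient_scale mU e0 q0 m1 (energy0 U) i2 (c1 _ q0)) ?powR_gt0//.
  congr (_ * _)%:E; rewrite expr0n/= mulr0 add0r sqr_sqrtr ?(ltW V0)//.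
  rewrite powRB ?(gt_eqF V0) ?implybT// powRr1 ?(ltW V0)//; congr (_ / _).
  by rewrite -powR_mulrn ?powR_ge0// -powRrM mulrC.
split.
  split=> //.
    by rewrite (Lr_norm_scale mU e0)// c1// -EFinM ltry.
  rewrite /gagliardo -/(gagliardo_kernel s one) -/(gagliardo_energy s _ one).
  by rewrite energy0 poweR_EFin ltry.
(* If 1 vanished almost everywhere on the dilated set, its L^q norm there would be 0, against
   [Lr_norm_scale]. *)
move=> ae0.
have : Lr_norm q (scale_set e U) one = 0%E.
  rewrite Lr_normE ?gt_eqF//.
  have -> : power_integral q (scale_set e U) one = 0%E.
    rewrite /power_integral (ae_eq_integral (cst 0%E)) ?integral0//.
      apply/measurable_EFinP; apply: (measurableT_comp (@measurable_powR R q)).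
      exact: measurableT_comp.
    by apply: filterS ae0 => x h Sx; have /eqP := h Sx; rewrite /one/= oner_eq0.
  by rewrite poweR0r// invr_neq0// gt_eqF.
rewrite (Lr_norm_scale mU e0 q0 m1) c1// -EFinM => -[] /eqP.
by rewrite gt_eqF// mulr_gt0 ?powR_gt0.
Qed.

(** Cauchy-Schwarz for (W, K r) and (a, g / r): the difference of the two sides is the square of the
    determinant. *)
Lemma cauchy_schwarz2 (R : realFieldType) (W K r a g : R) : 0 < r ->
  (W * a + K * g) ^+ 2 <= (W ^+ 2 + (K * r) ^+ 2) * (r ^- 2 * g ^+ 2 + a ^+ 2).
Proof.
move=> r0; rewrite -subr_ge0.
rewrite (_ : _ - _ = (W * g / r - K * r * a) ^+ 2) ?sqr_ge0//.
by field; rewrite gt_eqF.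
Qed.

Theorem lemma3p2 (R : realType) (n : nat) (Omega : set 'rV[R]_n) (s q : R)
    (n_gt0 : (0 < n)%N) (Omega_dom : bounded_smooth_domain Omega)
    (s_gt0 : 0 < s) (s_lt1 : s < 1)
    (q_ge1 : 1 <= q) (q_sub : (q%:E < critical_exponent n s)%E)
    (q_neq2 : q != 2) :
  (sobolev_constant s q (scale_set e Omega)
     / (e `^ (n%:R * (1 - 2 / q)))%:E)%E @[e --> 0^'+]
    --> (lebesgue_row n Omega `^ (1 - 2 / q))%E
  /\
  forall (u : R -> 'rV[R]_n -> R),
    let ubar (e : R) (x : 'rV[R]_n) : R := u e (e *: x) in
    (forall e : R, 0 < e ->
       extremal s q (scale_set e Omega) (u e) /\
       Lr_norm q Omega (ubar e) = 1%E) ->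
    exists b : R -> bool,
      (forall e : R, 0 < e ->
         {ae lebesgue_row n, forall x, Omega x -> 0 <= ubar e x} ->
         b e = false) /\
      Hs_norm s Omega
        (fun x => (-1) ^+ (b e) * ubar e x
                  - fine (lebesgue_row n Omega) `^ (- q^-1)) @[e --> 0^'+]
        --> 0%E.
Proof.
have [oU _ U0 bU _] := Omega_dom.
have mU := open_measurable_row oU.
have [V V0 UV] := lebesgue_row_bounded_open oU bU U0.
have [D D0 UD] := euclidean_bounded n_gt0 bU.
have [c c0 dU] := bounded_smooth_domain_measure_density Omega_dom.
have [C C0 PS] := poincare_sobolev n_gt0 s_gt0 D0 c0 V0 mU UV UD dU q_ge1 q_sub.
have q0 : 0 < q by exact: lt_le_trans q_ge1.
pose W := V `^ q^-1 / V `^ 2^-1; pose K := C * (1 + W).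
have W0 : 0 < W by rewrite divr_gt0 ?powR_gt0.
have K0 : 0 < K by rewrite mulr_gt0// addr_gt0.
have W2 : W ^- 2 = V `^ (1 - 2 / q).
  rewrite /W exprMn exprVn -!(powR_mulrn 2 (powR_ge0 _ _)) -!powRrM mulVf//.
  rewrite powRr1 ?(ltW V0)// invf_div powRB ?(gt_eqF V0) ?implybT//.
  by rewrite powRr1 ?(ltW V0)// [q^-1 * _]mulrC.
have es0 e : 0 < e -> 0 < e `^ s by move=> e0; rewrite powR_gt0.
have es2 e : e `^ (- (2 * s)) = (e `^ s) ^- 2.
  by rewrite powRN -powR_mulrn ?powR_ge0// -powRrM [s * _]mulrC.
have upper e : 0 < e -> (sobolev_constant s q (scale_set e Omega)
    <= (e `^ (n%:R * (1 - 2 / q)) * V `^ (1 - 2 / q))%:E)%E.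
  by move=> e0; exact: sobolev_constant_scale_le.
have lower e : 0 < e -> ((e `^ (n%:R * (1 - 2 / q)) /
    (W ^+ 2 + (K * e `^ s) ^+ 2))%:E <= sobolev_constant s q (scale_set e Omega))%E.
  move=> e0; apply: le_ereal_inf_tmp => _ [u Hu <-].
  have [Hsu _] := Hu; have [mu_ _ _] := Hsu.
  have mv := measurable_fun_scale mU e0 mu_.
  have [g [a [g0 a0 vg va]]] := Hs_scale_fin mU e0 Hsu.
  have vq := Lr_norm_le_energy mU V0 C0 q_ge1 UV PS mv g0 a0 vg va.
  have := Hs_nonzero_Lr_norm_gt0 mU e0 q0 Hu.
  move: vq; case vN : (Lr_norm q Omega _) => [N| |]//.
  rewrite lee_fin lte_fin -/W -/K => NWK N0.
  rewrite (sobolev_quotient_scale mU e0 q0 mu_ vg va vN N0) lee_fin.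
  rewrite ler_pM2l ?powR_gt0// es2.
  rewrite ler_pdivlMr ?exprn_gt0// mulrC ler_pdivrMr; last first.
    by rewrite addr_gt0// exprn_gt0// mulr_gt0// es0.
  (* Cauchy-Schwarz with r = e^s turns N <= W a + K g into the bound on the quotient. *)
  rewrite mulrC; apply: le_trans (cauchy_schwarz2 _ _ _ _ (es0 _ e0)).
  by rewrite ler_pXn2r ?nnegrE ?(ltW N0)// addr_ge0// mulr_ge0// ltW.
split.
  rewrite UV poweR_EFin.
  apply: (@squeeze_cvge _ _ _ _ (fun e => ((W ^+ 2 + (K * e `^ s) ^+ 2)^-1)%:E) _
    (fun=> (V `^ (1 - 2 / q))%:E)); last exact: cvg_cst.
    near=> e; have e0 : 0 < e by near: e; exact: nbhs_right_gt.
    have d0 : 0 < e `^ (n%:R * (1 - 2 / q)) by rewrite powR_gt0.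
    rewrite inver (gt_eqF d0) lee_pdivlMr// lee_pdivrMr// -!EFinM.
    by rewrite mulrC lower//= mulrC upper.
  rewrite -W2; apply: cvg_EFin; first by near=> e.
  have -> : W ^- 2 = (W ^+ 2 + (K * 0) ^+ 2)^-1 by rewrite mulr0 expr0n/= addr0.
  apply: cvgV; first by rewrite mulr0 expr0n/= addr0 expf_neq0// gt_eqF.
  apply: cvgD; first exact: cvg_cst.
  have Ks : K * e `^ s @[e --> 0^'+] --> K * 0.
    by apply: cvgM; [exact: cvg_cst|exact: powR_cvg0].
  by under eq_fun do rewrite expr2; rewrite expr2; exact: cvgM.
move=> u ubar Hu.
(* For an extremal normalised in L^q, the upper bound reads e^(-2s) g^2 + a^2 <= W^(-2), hence g <=
   L e^s. *)
pose L := W^-1.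
have L0 : 0 < L by rewrite invr_gt0.
(* The condition 0 < e stands under the existential so that [choice] gives [m] as a function of
   every real e. *)
have step (e : R) : exists m : R, 0 < e ->
    ({ae lebesgue_row n, forall x, Omega x -> 0 <= ubar e x} -> 0 <= m) /\
    (Hs_norm s Omega (fun x => (-1) ^+ (m < 0)%R * ubar e x - V `^ (- q^-1))%R
      <= ((1 + C * (1 + W^-1)) * (L * e `^ s))%:E)%E.
  have [e0|] := ltP 0 e; last by exists 0.
  have [[[Hsu nz] uS] v1] := Hu e e0.
  have [mu_ _ _] := Hsu; have mv := measurable_fun_scale mU e0 mu_.
  have [g [a [g0 a0 vg va]]] := Hs_scale_fin mU e0 Hsu.
  have t0 : 0 < L * e `^ s by rewrite mulr_gt0// es0.
  have vt : (gagliardo_energy s Omega (ubar e) <= ((L * e `^ s) ^+ 2)%:E)%E.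
    have := upper e e0; rewrite -uS.
    rewrite (sobolev_quotient_scale mU e0 q0 mu_ vg va v1 ltr01) lee_fin.
    rewrite ler_pM2l ?powR_gt0// expr1n divr1 es2 -W2 => h.
    rewrite vg lee_fin exprMn -ler_pdivrMr ?exprn_gt0 ?es0// mulrC.
    rewrite /L exprVn; apply: le_trans h; rewrite lerDl; exact: sqr_ge0.
  (* Choosing y in [P] makes m nonnegative as soon as [ubar e] is nonnegative almost everywhere, so
     that no sign is flipped in that case. *)
  pose P : set 'rV[R]_n := [set x |
    {ae lebesgue_row n, forall x, Omega x -> 0 <= ubar e x} -> 0 <= ubar e x].
  have aeP : {ae lebesgue_row n, forall x, Omega x -> P x}.
    have [h|h] := pselect {ae lebesgue_row n, forall x, Omega x -> 0 <= ubar e x}.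
      by apply: filterS h => x h Ux _; exact: h.
    by apply: nearW => x _ /h.
  have [y [_ Py] [y2 yq]] := PS _ _ P mv t0 vt aeP.
  exists (ubar e y) => _; split=> //.
  exact: (Hs_norm_near_constant mU V0 C0 q_ge1 UV mv t0 v1 vt y2 yq).
have [m hm] := choice step.
(* Extremals come with either sign; flipping those with [m e] negative makes the limit the positive
   constant. *)
exists (fun e => m e < 0); split.
  by move=> e e0 ae0; apply/negbTE; rewrite -leNgt; apply: (hm e e0).1.
apply: (@squeeze_cvge _ _ _ _ (fun=> 0%E) _
  (fun e => ((1 + C * (1 + W^-1)) * (L * e `^ s))%:E)); last 2 first.
- exact: cvg_cst.
- rewrite (_ : 0%E = ((1 + C * (1 + W^-1)) * (L * 0))%:E); last by rewrite !mulr0.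
  apply: cvg_EFin; first by near=> e.
  apply: cvgM; first exact: cvg_cst.
  by apply: cvgM; [exact: cvg_cst|exact: powR_cvg0].
near=> e; have e0 : 0 < e by near: e; exact: nbhs_right_gt.
by rewrite poweR_ge0/= UV; exact: (hm e e0).2.
Unshelve. all: by end_near. Qed.
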